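(* Let $d\ge 1$, let $(\varepsilon_i)_{i\in\mathbb{Z}}$ be i.i.d. integrable $\mathbb{R}^d$-valued random variables, and let $(b_j)_{j\ge0}$ be real numbers with $b_0\ne0$. Assume that either (i) $\sum_{j=0}^\infty|b_j|<\infty$, or (ii) $E[\varepsilon_0]=0$, $E[|\varepsilon_0|^2]<\infty$ and $\sum_{j=0}^\infty b_j^2<\infty$. Put $\xi_n=\sum_{j=0}^\infty b_j\varepsilon_{n-j}$, $n\in\mathbb{Z}$. Let $X_0$ be an integrable $\mathbb{R}^d$-valued random variable independent of $(\varepsilon_i)_{i\in\mathbb{Z}}$, and let $\nu:\mathbb{R}^d\to\mathbb{R}^d$ be a measurable function such that, for some $\kappa<1$, $$|\nu(x_1)-\nu(x_2)|\le\kappa|x_1-x_2|,\quad x_1,x_2\in\mathbb{R}^d.$$ Define $X_{n+1}=\nu(X_n)+\xi_{n+1}$ for $n\in\mathbb{N}=\{0,1,2,\dots\}$. Let $\mu_*$ be the Borel probability measure on $\mathbb{R}^d$ for which there is $C>0$ with $W_1(\mathcal{L}(X_n),\mu_* )\le C\kappa^n$ for all $n\in\mathbb{N}$. Assume that the characteristic function $\phi$ of $\varepsilon_0$ satisfies $$|\phi(u)|\le C_\flat(1+|u|)^{-d-\gamma},\quad u\in\mathbb{R}^d,$$ for some $\gamma,C_\flat>0$. Then there exist $C'>0$ and $\varrho<1$ such that $$d_{TV}(\mathcal{L}(X_n),\mu_* )\le C'\varrho^n,\quad n\in\mathbb{N}.$$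
   Context: $\mathcal{L}(X)$ is the law of $X$; $|\cdot|$ is the Euclidean norm; the characteristic function of $\varepsilon_0$ is $\phi(u)=E[e^{i\langle u,\varepsilon_0\rangle}]$. Under (i) or (ii) the series defining $\xi_n$ converges almost surely and in $L^1$. The Wasserstein-1 distance is $W_1(\mu_1,\mu_2)=\inf_{\pi}\int|x-y|\,\pi(dx,dy)$, the infimum being over couplings $\pi$ of $\mu_1,\mu_2$. The total variation distance is $d_{TV}(\mu_1,\mu_2)=\sup_{|f|\le1}|\int f\,d\mu_1-\int f\,d\mu_2|$, the supremum being over measurable $f:\mathbb{R}^d\to\mathbb{R}$ with $|f|\le1$. Under the contractivity assumption on $\nu$ and the assumptions on $X_0$ and $(\xi_n)$, a measure $\mu_*$ with the stated property exists and is unique. *)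

(* Defs.v *)
From HB Require Import structures.
From mathcomp Require Import all_boot all_order all_algebra finmap.
From mathcomp Require Import all_classical all_reals all_analysis.
From mathcomp Require Import complex.

Set Implicit Arguments.
Unset Strict Implicit.
Unset Printing Implicit Defensive.

Import Order.TTheory GRing.Theory Num.Theory.
Import numFieldNormedType.Exports.

Local Open Scope classical_set_scope.
Local Open Scope ring_scope.

(* Matrices, hence R^d seen as 'rV[R]_d, carry the Borel sigma-algebra of the
   library topology (which is the product topology, i.e. the Euclidean one). *)
HB.instance Definition _ (R : realType) (m n : nat) :=
  Measurable.copy 'M[R]_(m, n) (g_sigma_algebraType (@open 'M[R]_(m, n))).

Definition dotv (R : realType) (d : nat) (u v : 'rV[R]_d) : R :=
  \sum_(k < d) u 0 k * v 0 k.

(* The library norm on matrices is the sup norm. *)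
Definition enorm (R : realType) (d : nat) (u : 'rV[R]_d) : R :=
  Num.sqrt (\sum_(k < d) u 0 k ^+ 2).

Definition integrable_rv (dO : measure_display) (Omega : measurableType dO)
    (R : realType) (P : probability Omega R) (d : nat)
    (X : {mfun Omega >-> 'rV[R]_d}) : Prop :=
  P.-integrable [set: Omega] (fun w => (enorm (X w))%:E).

Definition vexpectation (dO : measure_display) (Omega : measurableType dO)
    (R : realType) (P : probability Omega R) (d : nat)
    (X : Omega -> 'rV[R]_d) : 'rV[R]_d :=
  \row_(k < d) fine 'E_P[fun w => X w 0 k].

Definition cexpectation (dO : measure_display) (Omega : measurableType dO)
    (R : realType) (P : probability Omega R) (Z : Omega -> R[i]) : R[i] :=
  (fine 'E_P[fun w => complex.Re (Z w)]
   +i* fine 'E_P[fun w => complex.Im (Z w)])%C.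

Definition cexpi (R : realType) (t : R) : R[i] := (cos t +i* sin t)%C.

Definition char_fun (dO : measure_display) (Omega : measurableType dO)
    (R : realType) (P : probability Omega R) (d : nat)
    (X : {mfun Omega >-> 'rV[R]_d}) (u : 'rV[R]_d) : R[i] :=
  cexpectation P (fun w => cexpi (dotv u (X w))).

Definition mutually_independent (dO : measure_display)
    (Omega : measurableType dO) (R : realType) (P : probability Omega R)
    (I : choiceType) (d' : measure_display) (T : measurableType d')
    (X : I -> {mfun Omega >-> T}) : Prop :=
  forall (J : {fset I}) (A : I -> set T), (forall i, measurable (A i)) ->
    P (\bigcap_(i in [set` J]) (X i @^-1` A i)) =
    (\prod_(i <- J) P (X i @^-1` A i))%E.

Definition identically_distributed (dO : measure_display)
    (Omega : measurableType dO) (R : realType) (P : probability Omega R)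
    (I : Type) (d' : measure_display) (T : measurableType d')
    (X : I -> {mfun Omega >-> T}) : Prop :=
  forall (i j : I) (A : set T), measurable A ->
    distribution P (X i) A = distribution P (X j) A.

Definition sigma_of_family (dO : measure_display) (Omega : measurableType dO)
    (I : Type) (d' : measure_display) (T : measurableType d')
    (X : I -> {mfun Omega >-> T}) : set (set Omega) :=
  <<s \bigcup_i preimage_set_system [set: Omega] (X i) measurable >>.

Definition independent_of_family (dO : measure_display)
    (Omega : measurableType dO) (R : realType) (P : probability Omega R)
    (I : Type) (d1 d2 : measure_display)
    (T1 : measurableType d1) (T2 : measurableType d2)
    (Y : {mfun Omega >-> T1}) (X : I -> {mfun Omega >-> T2}) : Prop :=
  forall (A : set T1) (B : set Omega),
    measurable A -> sigma_of_family X B ->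
    P (Y @^-1` A `&` B) = (P (Y @^-1` A) * P B)%E.

(* [limn] is total: on the event where the series diverges the value is
   arbitrary. *)
Definition linear_process (dO : measure_display) (Omega : measurableType dO)
    (R : realType) (d : nat) (b : nat -> R)
    (eps : int -> {mfun Omega >-> 'rV[R]_d}) (n : int) (w : Omega) : 'rV[R]_d :=
  limn (series (fun j : nat => b j *: eps (n - j%:Z) w)).

Definition coupling (R : realType) (d : nat)
    (mu1 mu2 : probability 'rV[R]_d R) :
    set (probability ('rV[R]_d * 'rV[R]_d)%type R) :=
  [set pi | forall A : set 'rV[R]_d, measurable A ->
     pi (fst @^-1` A) = mu1 A /\ pi (snd @^-1` A) = mu2 A].

Definition W1 (R : realType) (d : nat) (mu1 mu2 : probability 'rV[R]_d R) :
    \bar R :=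
  ereal_inf [set (\int[pi]_z (enorm (z.1 - z.2))%:E)%E
            | pi in coupling mu1 mu2].

Definition d_TV (R : realType) (d : nat) (mu1 mu2 : probability 'rV[R]_d R) :
    \bar R :=
  ereal_sup [set (`| \int[mu1]_x (f x)%:E - \int[mu2]_x (f x)%:E |)%E
            | f in [set f : 'rV[R]_d -> R |
                     measurable_fun setT f /\ forall x, `|f x| <= 1]].

(* Main.v *)
Require Import Defs.
From HB Require Import structures.
From mathcomp Require Import all_boot all_order all_algebra finmap.
From mathcomp Require Import all_classical all_reals all_analysis.
From mathcomp Require Import measurable_realfun complex ring lra.

Set Implicit Arguments.
Unset Strict Implicit.
Unset Printing Implicit Defensive.

Import Order.TTheory GRing.Theory Num.Theory.
Import numFieldNormedType.Exports.

Local Open Scope classical_set_scope.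
Local Open Scope ring_scope.

(* Write [X_(n+1) = Y + b_0 eps_(n+1)] with [Y] measurable with respect to the
   past, hence independent of [eps_(n+1)]: the characteristic function of the
   law of [X_(n+1)], and in the limit that of [mu], is bounded by
   [2 Cflat (1 + |b_0| |u|)^(-d-gamma)].  The Wasserstein bound makes the
   difference of the two characteristic functions at most a multiple of
   [|u| kappa^n], and interpolating geometrically between the two bounds gives
   [B q^n (1 + |b_0| |u|)^(-d-gamma/2)] with [q < 1].  This decay is integrable
   over [R^d], and it is transferred to test functions without densities: the
   tent function is the cosine transform of the Fejer kernel, so the two laws
   differ by [O(q^n N^-d)] on a product of tents of mesh [1/N].  A continuous
   function is interpolated on a cube of side [2r] by about [(2 r N)^d] such
   products, so the total error is [O(q^n r^d)] uniformly in [N]; outside the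
   cube Markov's inequality gives [O(1/r)].  Taking [r = rho^-n] with
   [rho^(d+1) = q] balances the two. *)

(** * The Fejer kernel and the tent function *)

(** Characteristic functions enter only through integrals of [cos (dotv u x + th)] with an arbitrary
    phase [th], which carries the real and the imaginary part at once and keeps all integrals real.
    Total variation asks for a bound uniform over test functions, so no modulus of continuity may
    survive: the mesh of the interpolation goes to 0 with the law index and the cube fixed, and this
    is possible because the bound for one product of tents and the number of products cancel exactly
    in the mesh. Tents are traded for frequencies one coordinate at a time, so the radial decay of
    order [d + gamma / 2] is first spread over the coordinates, as [1 + gamma / (2 d)] for each;
    here an exponent above [d] is essential. Independence meets an obstacle: the recursion and the
    series hold only almost surely, while the sigma-algebra of the past is not completed, so [Y] is
    built from versions defined everywhere. The first moments required by Markov's inequality are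
    read off the Wasserstein bound. As [X 0] contains no innovation, the estimates start at index
    1. *)

Lemma cos_lipschitz (R : realType) (a b : R) : `|cos a - cos b| <= `|a - b|.
Proof.
wlog ab : a b / a <= b.
  move=> h; have [/h//|/ltW/h] := leP a b.
  by rewrite (distrC (cos a)) (distrC a).
have [|c _ ab'] := @MVT_segment R cos (fun x => - sin x) a b ab.
  by apply: continuous_subspaceT => x; exact: continuous_cos.
rewrite (distrC (cos a)) (distrC a) ab' normrM normrN.
by rewrite ler_piMl// sin_max.
Qed.

Lemma one_sub_cos_le_sqr (R : realType) (u : R) : 1 - cos u <= u ^+ 2.
Proof.
wlog u0 : u / 0 <= u.
  move=> h; have [/h//|/ltW] := leP 0 u.
  by rewrite -oppr_ge0 => /h; rewrite cosN sqrrN.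
have [|c cu] := @MVT_segment R cos (fun x => - sin x) 0 u u0.
  by apply: continuous_subspaceT => x; exact: continuous_cos.
have c0 : 0 <= c by move: cu; rewrite in_itv /= => /andP[].
have [|e _] := @MVT_segment R sin cos 0 c c0.
  by apply: continuous_subspaceT => x; exact: continuous_sin.
rewrite sin0 cos0 !subr0 => -> /eqP; rewrite subr_eq addrC -subr_eq0 => /eqP H.
have -> : 1 - cos u = cos e * c * u.
  by lra.
rewrite expr2 ler_wpM2r//; move: cu; rewrite in_itv /= => /andP[_]; apply: le_trans.
by rewrite ler_piMl// cos_le1.
Qed.

Lemma integrable_le d (T : measurableType d) (R : realType)
    (m : {measure set T -> \bar R}) (f g : T -> R) :
  measurable_fun setT f -> (forall x, `|f x| <= g x) ->
  m.-integrable setT (EFin \o g) -> m.-integrable setT (EFin \o f).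
Proof.
move=> mf fg; apply: le_integrable => //; first exact/measurable_EFinP.
by move=> x _ /=; rewrite lee_fin (le_trans (fg x))// ler_norm.
Qed.

Lemma integrable_bounded d (T : measurableType d) (R : realType)
    (P : probability T R) (f : T -> R) (M : R) :
  measurable_fun setT f -> (forall x, `|f x| <= M) -> P.-integrable setT (EFin \o f).
Proof.
move=> mf fM; apply: (@integrable_le _ _ _ _ _ (fun=> M)) => //.
exact: finite_measure_integrable_cst.
Qed.

Section half_line.
Variable R : realType.
Local Notation mu := (@lebesgue_measure R).

Lemma is_derive_affine_powR (a p u : R) : 0 < 1 + a * u ->
  is_derive u (1:R) (fun u : R => (1 + a * u) `^ p) (a * p * (1 + a * u) `^ (p - 1)).
Proof.
move=> u0.
have h1 : is_derive u (1:R) (fun u : R => 1 + a * u) a.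
  by have := is_deriveD (is_derive_cst (1:R) u 1) (is_deriveZ a (is_derive_id u (1:R)));
     rewrite add0r [_ *: _]mulr1.
have h2 := @is_derive1_powR R p _ u0.
have h3 := @is_derive1_comp R (fun x : R => x `^ p) (fun u : R => 1 + a * u) u _ _ h2 h1.
by apply: is_derive_eq; rewrite /GRing.scale/=; ring.
Qed.

Lemma powR_decay_cvg0 (a s : R) : 0 < a -> 0 < s ->
  (1 + a * u) `^ (- s) @[u --> +oo] --> (0 : R).
Proof.
move=> a0 s0; apply/cvgrPdist_lt => e e0; near=> u.
have u0 : 0 < u by near: u; exact: nbhs_pinfty_gt.
have hu : (e^-1 `^ s^-1) / a < u.
  by near: u; apply: nbhs_pinfty_gt; rewrite num_real.
rewrite sub0r normrN ger0_norm ?powR_ge0// powRN.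
rewrite invf_plt ?posrE ?powR_gt0 ?ltr_pwDl ?mulr_ge0 ?(ltW a0) ?(ltW u0)//.
have -> : e^-1 = (e^-1 `^ s^-1) `^ s.
  by rewrite -powRrM mulVf ?gt_eqF// powRr1// invr_ge0 ltW.
have hv : e^-1 `^ s^-1 < 1 + a * u.
  move: hu; rewrite ltr_pdivrMr// mulrC => hu.
  by apply: (lt_trans hu); rewrite ltrDr.
apply: gt0_ltr_powR => //; rewrite nnegrE ?powR_ge0//.
by rewrite addr_ge0// mulr_ge0// ltW.
Unshelve. all: by end_near.
Qed.

Lemma integral_powR_decay (a s : R) : 0 < a -> 0 < s ->
  (\int[mu]_(u in `[0%R, +oo[) ((1 + a * u) `^ (- 1 - s))%:E = (a * s)^-1%:E)%E.
Proof.
move=> a0 s0.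
have pos (u : R) : 0 <= u -> 0 < 1 + a * u.
  by move=> u0; rewrite ltr_pwDl// mulr_ge0// ltW.
pose F (u : R) := - (a * s)^-1 * (1 + a * u) `^ (- s).
have dF (u : R) : 0 <= u -> is_derive u (1:R) F ((1 + a * u) `^ (- 1 - s)).
  move=> u0; have h4 := is_deriveZ (- (a * s)^-1) (is_derive_affine_powR (- s) (pos _ u0)).
  apply: is_derive_eq; rewrite /GRing.scale/=.
  by rewrite (addrC _ (-1)); field; rewrite ?gt_eqF.
rewrite (@ge0_continuous_FTC2y R _ F 0 0).
- by rewrite /F mulr0 addr0 powR1 mulr1 sub0e -EFinN opprK.
- by move=> x _; exact: powR_ge0.
- apply: derivable_within_continuous => x; rewrite in_itv/= andbT => x0.
  by have [] := is_derive_affine_powR (- 1 - s) (pos _ x0).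
- rewrite -(mulr0 (- (a * s)^-1)); apply: cvgM; first exact: cvg_cst.
  exact: powR_decay_cvg0.
- by move=> x x0; have [] := dF x (ltW x0).
- have [d0 _] := dF 0 (lexx _).
  apply: cvg_at_right_filter.
  exact/differentiable_continuous/derivable1_diffP.
- move=> x; rewrite in_itv/= andbT => x0.
  by have [_] := dF x (ltW x0); rewrite derive1E.
Qed.

(** The image of Lebesgue measure under multiplication by [a], rescaled by [a], agrees with Lebesgue
    measure on half-open intervals, hence on all Borel sets; the rest is integration against an
    image measure. *)
Lemma integral_scaling (a : R) (f : R -> \bar R) : 0 < a ->
  measurable_fun [set: measurableTypeR R] f -> (forall x, 0 <= f x)%E ->
  (\int[mu]_x f x = a%:E * \int[mu]_x f (a * x)%R)%E.
Proof.
move=> a0 mf f0.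
have ma : measurable_fun [set: measurableTypeR R] ( *%R a : _ -> measurableTypeR R).
  exact: mulrl_measurable.
have an : 0 <= a by exact: ltW.
have aVn : 0 <= a^-1 by rewrite invr_ge0.
have muE (A : set R) : measurable A ->
    mu A = (a%:E * mu (( *%R a : _ -> measurableTypeR R) @^-1` A))%E.
  move=> mA.
  unshelve refine (@lebesgue_measure_unique R (mscale (NngNum an)
    (pushforward mu ( *%R a : _ -> measurableTypeR R))) _ A mA) => //.
  move=> _ [[u v]] _ <-.
  have aE : *%R a @^-1` `]u, v] = `]u / a, v / a]%classic.
    by apply/seteqP; split => x /=; rewrite !in_itv/=;
       rewrite ltr_pdivrMr// ler_pdivlMr// [a * _]mulrC.
  transitivity (a%:E * mu [set` `]u / a, v / a]%R])%E; last by rewrite -aE.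
  rewrite [LHS]lebesgue_measure_itv [X in (_ * X)%E]lebesgue_measure_itv/=.
  rewrite !lte_fin ltr_pM2r ?invr_gt0//.
  case: ifPn => _; last by rewrite mule0.
  by rewrite -!EFinB -EFinM; congr EFin; field; rewrite gt_eqF.
have -> : (\int[mu]_x f (a * x)%R = a^-1%:E * \int[mu]_x f x)%E.
  transitivity (\int[pushforward mu ( *%R a : _ -> measurableTypeR R)]_x f x)%E.
    by rewrite ge0_integral_pushforward.
  transitivity (\int[mscale (NngNum aVn) mu]_x f x)%E.
    apply: eq_measure_integral => //= A mA _; rewrite /mscale/=.
    by rewrite muE// muleA -EFinM mulVf ?mul1e// gt_eqF.
  by rewrite ge0_integral_mscale.
by rewrite muleA -EFinM mulfV ?mul1e// gt_eqF.
Qed.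

(** Cut to the half line, where the real power is a genuine [1 / u ^+ 2] for [u > 0], and at [0] the
    factor [1 - cos 0] vanishes. The cosine transform of an even kernel needs only this half. *)
Definition fejer (a u : R) := \1_(`[0%R, +oo[) u * ((1 - cos (a * u)) * u `^ (- 2)).

Lemma fejer_ge0 a u : 0 <= fejer a u.
Proof. by rewrite !mulr_ge0 ?powR_ge0// subr_ge0 cos_le1. Qed.

Lemma measurable_fejer a : measurable_fun [set: R] (fejer a).
Proof.
apply: measurable_funM; first exact: measurable_indic.
apply: measurable_funM; last exact: measurable_powR.
apply: measurable_funB => //; apply: measurableT_comp => //.
exact: (continuous_measurable_fun (@continuous_cos R)).
Qed.

Lemma fejer_scale (a u : R) : 0 < a -> fejer a u = a ^+ 2 * fejer 1 (a * u).
Proof.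
move=> a0; rewrite /fejer mul1r !indicE !mem_setE !in_itv/= !andbT.
rewrite pmulr_rge0//; have [u0|_] := leP 0 u; last by rewrite !mul0r mulr0.
rewrite !mul1r powRM// ?(ltW a0)// (powR_invn 2 (ltW a0)).
by field; rewrite gt_eqF.
Qed.

(** In [tents_cos_bound] integrability at infinity is supplied by the decay of the cosine integrals,
    and only this boundedness of the kernel is used. *)
Lemma fejer1_le_indic (u : R) : fejer 1 u <= \1_(`[0%R, +oo[) u.
Proof.
rewrite /fejer indicE mem_setE in_itv/= andbT mul1r.
have [u0|_] := leP 0 u; last by rewrite mul0r.
rewrite mul1r (powR_invn 2 u0).
have [->|un0] := eqVneq u 0; first by rewrite cos0 subrr mul0r.
rewrite ler_pdivrMr; last by rewrite exprn_gt0// lt_def un0.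
by rewrite mul1r one_sub_cos_le_sqr.
Qed.

(** Both [1 - cos u <= u ^+ 2], used up to 1, and [1 - cos u <= 2], used beyond 1, lead to the
    constant 8. The right-hand side has the shape of [integrable_powR_decay] with [a = s = 1]. *)
Lemma fejer1_le_powR (u : R) : fejer 1 u <= 8 * (\1_(`[0%R, +oo[) u * (1 + 1 * u) `^ (- 1 - 1)).
Proof.
rewrite mulrCA /fejer !indicE !mem_setE in_itv/= andbT !mul1r.
have [u0|_] := leP 0 u; last by rewrite !mul0r.
rewrite !mul1r (_ : -1 - 1 = - 2 :> R); last by lra.
rewrite (powR_invn 2 u0) (powR_invn 2) ?addr_ge0//.
have [->|un0] := eqVneq u 0; first by rewrite cos0 subrr mul0r mulr_ge0// invr_ge0 sqr_ge0.
have {}u0 : 0 < u by rewrite lt_def un0.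
rewrite ler_pdivrMr ?exprn_gt0// mulrAC ler_pdivlMr ?exprn_gt0 ?addr_gt0//.
have h1 := one_sub_cos_le_sqr u.
have h2 : 1 - cos u <= 2 by rewrite lerBlDr -lerBlDl (le_trans _ (cos_geN1 u))//; lra.
have h3 : 0 <= 1 - cos u by rewrite subr_ge0 cos_le1.
have [u1|u1] := leP u 1.
  apply: (@le_trans _ _ (u ^+ 2 * 4)); last by nra.
  by apply: ler_pM => //; nra.
apply: (@le_trans _ _ (2 * (4 * u ^+ 2))); last by nra.
by apply: ler_pM => //; nra.
Qed.

Lemma integrable_powR_decay (a s : R) : 0 < a -> 0 < s ->
  mu.-integrable [set: R]
    (fun u => (\1_(`[0%R, +oo[) u * (1 + a * u) `^ (- 1 - s))%:E).
Proof.
move=> a0 s0; apply/integrableP; split.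
  apply/measurable_EFinP; apply: measurable_funM => //.
  apply: (measurableT_comp (measurable_powR _)).
  by apply: measurable_funD => //; exact: mulrl_measurable.
rewrite (_ : (\int[mu]_x _)%E =
  (\int[mu]_(u in `[0%R, +oo[) ((1 + a * u) `^ (- 1 - s))%:E)%E).
  by rewrite integral_powR_decay// ltry.
rewrite [RHS]integral_mkcond; apply: eq_integral => x _.
rewrite patchE indicE; case: ifPn => xD; rewrite ?mul1r ?mul0r/= ?normr0//.
by rewrite ger0_norm// powR_ge0.
Qed.

Lemma Rintegral_powR_decay (a s : R) : 0 < a -> 0 < s ->
  \int[mu]_u (\1_(`[0%R, +oo[) u * (1 + a * u) `^ (- 1 - s)) = (a * s)^-1.
Proof.
move=> a0 s0; rewrite /Rintegral -[RHS]/(fine (_%:E)) -integral_powR_decay//.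
congr fine; rewrite [RHS]integral_mkcond; apply: eq_integral => x _.
by rewrite patchE indicE; case: ifPn => xD; rewrite ?mul1r ?mul0r.
Qed.

Lemma integrable_fejer1 : mu.-integrable [set: R] (EFin \o fejer 1).
Proof.
apply: (@integrable_le _ (measurableTypeR R) _ _ _
  (fun u : R => 8 * (\1_(`[0%R, +oo[) u * (1 + 1 * u) `^ (- 1 - 1)) : R)).
- exact: measurable_fejer.
- by move=> u; rewrite ger0_norm ?fejer_ge0// fejer1_le_powR.
- exact: (integrableZl measurableT 8 (integrable_powR_decay ltr01 ltr01)).
Qed.

Definition fejer_mass := \int[mu]_u fejer 1 u.

Lemma fejer_mass_gt0 : 0 < fejer_mass.
Proof.
have pi1 : 1 <= pi :> R by rewrite (le_trans _ (pi_ge2 R))// ler1n.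
have c1 : cos (1 : R) < 1.
  by rewrite -[X in _ < X]cos0 ltr_cos ?in_itv/= ?lexx ?pi_ge0 ?ler01 ?pi1.
(* On [[1, 2]], which lies in [[0, pi]], the cosine decreases, so [1 - cos u >= 1 - cos 1], and
   [u ^- 2 >= 1 / 4]. *)
pose h (u : R) := \1_(`[1%R, 2%R]) u * ((1 - cos 1) / 4) : R.
have hf u : h u <= fejer 1 u.
  rewrite /h indicE mem_setE in_itv/=.
  case: (boolP (1 <= u <= 2)) => [/andP[u1 u2]|_]/=; last first.
    by rewrite mul0r fejer_ge0.
  have u0 : 0 <= u by rewrite (le_trans _ u1).
  rewrite /fejer indicE mem_setE in_itv/= u0/= !mul1r (powR_invn 2 u0).
  apply: ler_pM; rewrite ?subr_ge0 ?cos_le1//.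
    rewrite lerB//; have [->//|un1] := eqVneq u 1.
    rewrite ltW// ltr_cos ?in_itv/= ?ler01 ?u0 ?pi1//=; first by rewrite lt_def un1.
    by rewrite (le_trans u2)// pi_ge2.
  by rewrite lef_pV2 ?posrE ?exprn_gt0//; [nra|lra].
have i1 : mu.-integrable [set: R] (EFin \o h).
  apply: (@integrable_le _ (measurableTypeR R) _ _ _ (fejer 1)) integrable_fejer1.
    exact: measurable_funM.
  move=> u; rewrite ger0_norm//.
  by rewrite mulr_ge0// divr_ge0// subr_ge0 cos_le1.
apply: lt_le_trans (le_Rintegral _ i1 integrable_fejer1 (fun u _ => hf u)) => //.
rewrite RintegralZr//; last exact: integrable_indic_itv.
rewrite /Rintegral integral_indic// setIT [X in fine X](_ : _ = 1%E) ?mul1r.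
  by rewrite divr_gt0 ?subr_gt0.
transitivity (mu [set` `[1%R, 2%R]]) => //.
by rewrite lebesgue_measure_itv/= lte_fin ltr1n -EFinB; congr EFin; lra.
Qed.

(* By scaling; the value [pi / 2] of [fejer_mass] is never needed. *)
Lemma integral_fejer (a : R) :
  (\int[mu]_u (fejer a u)%:E = (`|a| * fejer_mass)%:E)%E.
Proof.
wlog a0 : a / 0 <= a => [h|].
  have [/h//|/ltW] := leP 0 a; rewrite -oppr_ge0 => /h; rewrite normrN => <-.
  by apply: eq_integral => u _; rewrite /fejer/= mulNr cosN.
have [->|an0] := eqVneq a 0.
  rewrite normr0 mul0r; apply: integral0_eq => u _.
  by rewrite /fejer mul0r cos0 subrr mul0r mulr0.
have {an0}a0 : 0 < a by rewrite lt_def an0.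
have f1 : (\int[mu]_u (fejer 1 u)%:E = fejer_mass%:E)%E.
  by rewrite fineK//; exact: integrable_fin_num integrable_fejer1.
under eq_integral do rewrite fejer_scale// EFinM.
rewrite ge0_integralZl//.
- have := @integral_scaling a (EFin \o fejer 1) a0; rewrite f1.
  move=> /(_ _ _)/esym sc; rewrite expr2 EFinM -muleA sc//.
  + by rewrite gtr0_norm// EFinM.
  + by apply/measurable_EFinP; exact: measurable_fejer.
  + by move=> x /=; rewrite lee_fin fejer_ge0.
- apply/measurable_EFinP; apply: measurableT_comp; first exact: measurable_fejer.
  exact: mulrl_measurable.
- by move=> x _; rewrite lee_fin fejer_ge0.
- by rewrite lee_fin sqr_ge0.
Qed.

Lemma integrable_fejer (a : R) : mu.-integrable [set: R] (EFin \o fejer a).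
Proof.
apply/integrableP; split; first by apply/measurable_EFinP; exact: measurable_fejer.
under eq_integral do rewrite /= ger0_norm ?fejer_ge0//.
by rewrite integral_fejer ltry.
Qed.

Lemma Rintegral_fejer (a : R) : \int[mu]_u fejer a u = `|a| * fejer_mass.
Proof. by rewrite /Rintegral integral_fejer. Qed.

Definition tent (x : R) := Num.max 0 (1 - `|x|).

Lemma tentE x : tent x = 2^-1 * (`|x + 1| + `|x - 1|) - `|x|.
Proof.
rewrite /tent; case: (ger0P x) => x0; case: (ger0P (x+1)) => x1; case: (ger0P (x-1)) => x2;
 rewrite maxEle; case: ifPn => h; lra.
Qed.

(* Half the second difference in [x] of [`|x|], by [Rintegral_fejer]. *)
Lemma tent_fejer x : fejer_mass * tent x = \int[mu]_u (fejer 1 u * cos (u * x)).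
Proof.
(* Product-to-sum gives [(1 - cos u) * cos (u * x)] as [cos (u * x)] minus the mean of
   [cos (u * (x + 1))] and [cos (u * (x - 1))]; inserting [1 - 1] turns each cosine into a kernel
   that is integrable on its own. *)
have fjE u : fejer 1 u * cos (u * x) =
    2^-1 * (fejer (x + 1) u + fejer (x - 1) u) - fejer x u.
  rewrite /fejer mulrC -!(mulrC (u `^ (-2))) -!(mulrCA (u `^ (-2))).
  rewrite !mul1r mulrDl mulrBl !mul1r cosD cosB (mulrC x u); by field.
under eq_Rintegral do rewrite fjE.
have iD : mu.-integrable setT (EFin \o (fun u => fejer (x + 1) u + fejer (x - 1) u)).
  exact: (integrableD measurableT (integrable_fejer _) (integrable_fejer _)).
rewrite RintegralB//; last 2 first.
  exact: (integrableZl measurableT _ iD).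
  exact: integrable_fejer.
rewrite RintegralZl// RintegralD//; try exact: integrable_fejer.
by rewrite !Rintegral_fejer tentE; ring.
Qed.

End half_line.

(** * Continuous test functions suffice *)

Section borel_rV.
Variables (R : realType) (d : nat).

Lemma open_measurable_rV (U : set 'rV[R]_d) : open U -> measurable U.
Proof. by move=> oU; exact: sub_sigma_algebra. Qed.

Lemma continuous_measurable_rV (f : 'rV[R]_d -> R) :
  continuous f -> measurable_fun setT f.
Proof.
move=> /continuousP cf; apply: (measurability _ (RGenOpens.measurableE R)).
by move=> _ [_ [a [b ->]] <-]; rewrite setTI; apply: open_measurable_rV; apply: cf; exact: interval_open.
Qed.

Lemma measurable_coord (k : 'I_d) : measurable_fun setT (fun x : 'rV[R]_d => x 0 k).
Proof. by apply: continuous_measurable_rV; exact: coord_continuous. Qed.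

(** An open set is a countable union of balls with rational centre and radius [1 / (n + 1)], and a
    ball of the sup norm is a finite intersection of conditions on single coordinates. *)
Lemma measurable_rV d0 (T : measurableType d0) (f : T -> 'rV[R]_d) :
  (forall k, measurable_fun setT (fun t => f t 0 k)) -> measurable_fun setT f.
Proof.
move=> mf; apply: (@measurability _ _ _ _ _ _ (@open 'rV[R]_d)) => //.
move=> _ [U oU <-]; rewrite setTI.
pose q2r (q : 'rV[rat]_d) : 'rV[R]_d := map_mx ratr q.
pose bq (p : 'rV[rat]_d * nat) := ball (q2r p.1) (p.2.+1%:R^-1 : R).
pose F (p : 'rV[rat]_d * nat) := if `[< bq p `<=` U >] then f @^-1` bq p else set0.
have -> : f @^-1` U = \bigcup_p F p.
  apply/seteqP; split => [t /= Uft|t [p _]]; last first.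
    by rewrite /F; case: asboolP => // bU bf; exact: bU.
  have /nbhs_ballP[e /= e0 eU] : nbhs (f t) U by exact: open_nbhs_nbhs.
  have [n hn] : exists n : nat, n.+1%:R^-1 < e / 2.
    have /ltr_add_invr[n] : 0 < e / 2 by rewrite divr_gt0.
    by rewrite add0r; exists n.
  have hq k : exists q : rat, `|ratr q - f t 0 k| < n.+1%:R^-1.
    have /rat_in_itvoo[q] : f t 0 k - n.+1%:R^-1 < f t 0 k + n.+1%:R^-1.
      by rewrite ltrD2l (@lt_trans _ _ 0)// ?oppr_lt0 invr_gt0.
    rewrite in_itv/= => /andP[q1 q2]; exists q.
    by rewrite ltr_distl q1 q2.
  have [g hg] := choice hq.
  exists (\row_k g k, n) => //; rewrite /F.
  have bqt : bq (\row_k g k, n) (f t).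
    split; first by rewrite /= invr_gt0.
    by move=> i j; rewrite ord1 /= /ball/= !mxE; exact: hg.
  rewrite asboolT//= => y bqy; apply: eU.
  have -> : e = n.+1%:R^-1 + (e - n.+1%:R^-1) by rewrite addrC subrK.
  apply: ball_triangle (ball_sym bqt) _.
  by apply: le_ball bqy; rewrite /= lerBrDl (le_trans (lerD (ltW hn) (ltW hn)))// -splitr.
apply: countable_bigcupT_measurable => // p; rewrite /F; case: asboolP => // _.
have -> : f @^-1` bq p = \bigcap_(k in [set: 'I_d]) [set t | `|q2r p.1 0 k - f t 0 k| < p.2.+1%:R^-1].
  apply/seteqP; split => [t [_ h] k _|t h]; first exact: h.
  by split; [rewrite /= invr_gt0|move=> i j; rewrite ord1; exact: h].
apply: fin_bigcap_measurable => // k _.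
have mg : measurable_fun setT (fun t => `|q2r p.1 0 k - f t 0 k|).
  apply: measurableT_comp; first exact: normr_measurable.
  by apply: measurable_funB => //.
rewrite -[X in measurable X]setTI.
rewrite (_ : [set t | _] = (fun t => `|q2r p.1 0 k - f t 0 k|) @^-1` `]-oo, p.2.+1%:R^-1[).
  exact: mg.
by apply/seteqP; split => t /=; rewrite in_itv.
Qed.

Lemma measurable_box (c : R) : measurable [set x : 'rV[R]_d | forall k, `|x 0 k| <= c].
Proof.
rewrite (_ : [set _ | _] =
    \bigcap_(k in [set: 'I_d]) ((fun x : 'rV[R]_d => `|x 0 k|) @^-1` `]-oo, c])).
  apply: fin_bigcap_measurable => // k _; rewrite -[X in measurable X]setTI.
  have mk : measurable_fun setT (fun x : 'rV[R]_d => `|x 0 k|).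
    by apply: measurableT_comp; [exact: normr_measurable|exact: measurable_coord].
  exact: mk.
apply/seteqP; split => [x xb k _ /=|x xb k]; first by rewrite in_itv/= xb.
by have := xb k I; rewrite /= in_itv.
Qed.

End borel_rV.

Lemma cvg_Rintegral_bounded d (T : measurableType d) (R : realType)
    (P : probability T R) (f_ : nat -> T -> R) (f : T -> R) (M : R) :
  (forall n, measurable_fun setT (f_ n)) -> measurable_fun setT f ->
  (forall n x, `|f_ n x| <= M) ->
  {ae P, forall x, f_ n x @[n --> \oo] --> f x} ->
  \int[P]_x f_ n x @[n --> \oo] --> \int[P]_x f x.
Proof.
move=> mf_ mf fM f_f.
have [|||||I _ H] := @dominated_convergence _ _ _ P setT measurableT
  (fun n => EFin \o f_ n) (EFin \o f) (fun=> M%:E).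
- by move=> n; exact/measurable_EFinP.
- exact/measurable_EFinP.
- case: f_f => N [mN N0 Nsub]; exists N; split => //.
  apply: subset_trans Nsub => x /= h1 h2; apply: h1 => _.
  exact: (cvg_comp _ _ h2).
- exact: finite_measure_integrable_cst.
- by apply: aeW => x n _; rewrite lee_fin.
rewrite /Rintegral; apply: fine_cvg; rewrite fineK//.
exact: (integrable_fin_num measurableT I).
Qed.

Section continuous_approximation.
Variables (R : realType) (d : nat) (mu1 mu2 : probability 'rV[R]_d R).

Definition unit_valued (f : 'rV[R]_d -> R) :=
  measurable_fun setT f /\ forall x, 0 <= f x <= 1.

(** The distance of [L^1(mu1 + mu2)]: one continuous function has to approximate under both laws at
    once. *)
Definition l1_dist2 (f g : 'rV[R]_d -> R) :=
  \int[mu1]_x `|f x - g x| + \int[mu2]_x `|f x - g x|.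

Definition continuous_approx (f : 'rV[R]_d -> R) := unit_valued f /\
  forall e, 0 < e -> exists h, [/\ unit_valued h, continuous h & l1_dist2 f h <= e].

Lemma unit_valued_distr f g x : unit_valued f -> unit_valued g -> `|f x - g x| <= 1.
Proof.
by move=> [_ /(_ x)/andP[f0 f1]] [_ /(_ x)/andP[g0 g1]]; rewrite ler_norml; lra.
Qed.

Lemma measurable_distr f g : unit_valued f -> unit_valued g ->
  measurable_fun setT (fun x => `|f x - g x|).
Proof.
move=> [mf _] [mg _]; apply: measurableT_comp; first exact: normr_measurable.
exact: measurable_funB.
Qed.

Lemma integrable_distr (mu : probability 'rV[R]_d R) f g :
  unit_valued f -> unit_valued g ->
  mu.-integrable setT (EFin \o (fun x => `|f x - g x|)).
Proof.
move=> uf ug; apply: (@integrable_bounded _ _ _ _ _ 1); first exact: measurable_distr.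
by move=> x; rewrite normr_id unit_valued_distr.
Qed.

Lemma l1_dist2_le f g f1 g1 f2 g2 (c1 c2 : R) :
  unit_valued f -> unit_valued g -> unit_valued f1 -> unit_valued g1 ->
  unit_valued f2 -> unit_valued g2 ->
  (forall x, `|f x - g x| <= c1 * `|f1 x - g1 x| + c2 * `|f2 x - g2 x|) ->
  l1_dist2 f g <= c1 * l1_dist2 f1 g1 + c2 * l1_dist2 f2 g2.
Proof.
move=> uf ug uf1 ug1 uf2 ug2 le.
have H (mu : probability 'rV[R]_d R) : \int[mu]_x `|f x - g x| <=
    c1 * \int[mu]_x `|f1 x - g1 x| + c2 * \int[mu]_x `|f2 x - g2 x|.
  have i1 := integrableZl measurableT c1 (integrable_distr mu uf1 ug1).
  have i2 := integrableZl measurableT c2 (integrable_distr mu uf2 ug2).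
  rewrite -!RintegralZl//; try exact: integrable_distr.
  rewrite -RintegralD//.
  apply: le_Rintegral => //; first exact: integrable_distr.
  exact: (integrableD measurableT i1 i2).
by rewrite /l1_dist2 !mulrDr addrACA lerD.
Qed.

Lemma continuous_approx_lim (f_ : nat -> 'rV[R]_d -> R) f :
  (forall n, continuous_approx (f_ n)) -> unit_valued f ->
  (forall x, f_ n x @[n --> \oo] --> f x) -> continuous_approx f.
Proof.
move=> af uf f_f; split => // e e0; have e2 : 0 < e / 2 by rewrite divr_gt0.
have H (mu : probability 'rV[R]_d R) :
    \int[mu]_x `|f x - f_ n x| @[n --> \oo] --> (0 : R).
  rewrite (_ : 0 = \int[mu]_x 0); last by rewrite Rintegral_cst// mul0r.
  apply: (@cvg_Rintegral_bounded _ _ _ _ _ _ 1) => //.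
  - by move=> n; apply: measurable_distr => //; exact: (af n).1.
  - by move=> n x; rewrite normr_id; apply: unit_valued_distr => //; exact: (af n).1.
  - apply: aeW => x; rewrite -[X in _ --> X](@normr0 _ R) -(subrr (f x)).
    by apply: cvg_norm; apply: cvgB => //; exact: cvg_cst.
have : l1_dist2 f (f_ n) @[n --> \oo] --> (0 + 0 : R) by apply: cvgD.
rewrite addr0 => /cvgrPdist_lt/(_ _ e2)[N _ /(_ N (leqnn N))/=].
rewrite sub0r normrN => /ltW/(le_trans (ler_norm _)) hN.
have [h [uh ch lh]] := (af N).2 _ e2.
exists h; split => //.
apply: (le_trans (@l1_dist2_le f h f (f_ N) (f_ N) h 1 1 uf uh uf (af N).1 (af N).1 uh _)).
  by move=> x; rewrite !mul1r ler_distD.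
by rewrite !mul1r [leRHS]splitr lerD.
Qed.

Lemma unit_valued_indic (A : set 'rV[R]_d) : measurable A -> unit_valued \1_A.
Proof.
move=> mA; split; first exact: measurable_indic.
by move=> x; rewrite indicE; case: (_ \in _); rewrite /= ?lexx ?ler01.
Qed.

Lemma l1_dist2_refl f : l1_dist2 f f = 0.
Proof.
rewrite /l1_dist2; under eq_Rintegral do rewrite subrr normr0.
under [X in _ + X]eq_Rintegral do rewrite subrr normr0.
by rewrite !Rintegral_cst// !mul0r addr0.
Qed.

(** Urysohn functions that vanish off [U] and equal 1 at the points whose ball of radius
    [1 / (n + 1)] lies in [U] converge pointwise to the indicator of [U]. *)
Lemma continuous_approx_open (U : set 'rV[R]_d) : open U -> continuous_approx \1_U.
Proof.
move=> oU.
pose A n := [set x : 'rV[R]_d | ball x (n.+1%:R^-1 : R) `<=` U].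
have sepA n : uniform_separator (~` U) (A n).
  exists (Uniform.class 'rV[R]_d), [set xy | ball xy.1 (n.+1%:R^-1 : R) xy.2].
  split; first exact: (entourage_ball _ (n.+1%:R^-1)%:pos).
    apply/seteqP; split => // -[x y] /= [[Ux Ay] bxy].
    by apply: Ux; apply: Ay; exact: ball_sym.
  by move=> x B.
have /choice[h hP] n := (@uniform_separatorP _ R _ _).1 (sepA n).
apply: (@continuous_approx_lim h).
- move=> n; have [ch h01 _ _] := hP n.
  have uh : unit_valued (h n).
    split; first exact: continuous_measurable_rV.
    by move=> x; have /= := h01 (h n x); rewrite in_itv/=; apply; exists x.
  by split => // e e0; exists (h n); split => //; rewrite l1_dist2_refl ltW.
- apply: unit_valued_indic; exact: open_measurable_rV.
- move=> x; rewrite indicE; have [Ux|Ux] := pselect (U x).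
    rewrite mem_set//=; have /nbhs_ballP[e /= e0 eU] : nbhs x U by exact: open_nbhs_nbhs.
    have [N hN] : exists N : nat, N.+1%:R^-1 < e.
      by have /ltr_add_invr[N] := e0; rewrite add0r; exists N.
    apply: cvg_near_cst; exists N => // n /= Nn.
    have [_ _ _ h1] := hP n; apply: h1; exists x => //= y bxy; apply: eU.
    apply: le_ball bxy; rewrite (le_trans _ (ltW hN))// lef_pV2 ?posrE//.
    by rewrite ler_nat ltnS.
  rewrite memNset//=; apply: cvg_near_cst; apply: nearW => n.
  by have [_ _ h0 _] := hP n; apply: h0; exists x.
Qed.

Lemma continuous_approx_setD (A B : set 'rV[R]_d) : B `<=` A ->
  measurable A -> measurable B ->
  continuous_approx \1_A -> continuous_approx \1_B -> continuous_approx \1_(A `\` B).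
Proof.
move=> BA mA mB [uA hA] [uB hB].
have uAB := unit_valued_indic (measurableD mA mB).
split => // e e0; have e2 : 0 < e / 2 by rewrite divr_gt0.
have [h1 [uh1 ch1 Lh1]] := hA _ e2; have [h2 [uh2 ch2 Lh2]] := hB _ e2.
(* The positive part is 1-Lipschitz, sends [\1_A - \1_B] to the indicator of the difference, and
   brings [h1 - h2] back into [[0, 1]]. *)
pose h x := Num.max (h1 x - h2 x) 0.
have ch : continuous h.
  move=> x; apply: (@continuous_max _ _ (fun x => h1 x - h2 x) (fun=> 0)).
    by apply: continuousB; [exact: ch1|exact: ch2].
  exact: (@cst_continuous _ R^o).
have uh : unit_valued h.
  split; first exact: continuous_measurable_rV.
  move=> x; have := uh1.2 x; have := uh2.2 x; rewrite /h.
  by move=> /andP[? ?] /andP[? ?]; rewrite maxEle; case: ifPn => ?; lra.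
exists h; split => //.
apply: (le_trans (@l1_dist2_le _ _ \1_A h1 \1_B h2 1 1 uAB uh uA uh1 uB uh2 _)); last first.
  by rewrite !mul1r [leRHS]splitr lerD.
move=> x; rewrite !mul1r.
have -> : \1_(A `\` B) x = Num.max (\1_A x - \1_B x) 0 :> R.
  rewrite !indicE in_setD; case: (boolP (x \in A)) => xA; case: (boolP (x \in B)) => xB;
    rewrite /= ?subrr ?subr0 ?maxxx//.
    by rewrite maxEle ler10.
  by move: xB xA; rewrite notin_setE inE => /BA.
rewrite /h; move: (h1 x) (h2 x) (\1_A x : R) (\1_B x : R) => a b p q.
case: (ger0P (p - a)) => ?; case: (ger0P (q - b)) => ?; rewrite ler_norml !maxEle;
  case: ifPn; rewrite -?ltNge => ?; case: ifPn; rewrite -?ltNge => ?; lra.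
Qed.

(** Dynkin's argument: open sets are stable under finite intersection, and approximable indicators
    under proper difference and increasing union. Measurability is carried along because both
    closure steps require it. *)
Lemma continuous_approx_measurable (A : set 'rV[R]_d) :
  measurable A -> continuous_approx \1_A.
Proof.
suff : <<s @open 'rV[R]_d >> `<=` [set A | measurable A /\ continuous_approx \1_A].
  by move=> h mA; have [] := h A mA.
apply: lambda_system_subset => //.
- by move=> B C oB oC; exact: openI.
- split => //.
  + by split => //; apply: continuous_approx_open; exact: openT.
  + move=> B C CB [mB aB] [mC aC]; split; first exact: measurableD.
    exact: continuous_approx_setD.
  + move=> F ndF F_; have mF : measurable (\bigcup_i F i).
      by apply: bigcupT_measurable => i; exact: (F_ i).1.
    split => //; apply: (@continuous_approx_lim (fun n => \1_(F n))).
    * by move=> n; exact: (F_ n).2.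
    * exact: unit_valued_indic.
    * move=> x; rewrite [X in _ --> X]indicE.
      have [Ux|Ux] := pselect ((\bigcup_i F i) x).
        rewrite mem_set//=; have [N _ FN] := Ux; apply: cvg_near_cst; exists N => // n /= Nn.
        rewrite indicE mem_set//; move: Nn => /ndF; rewrite subsetEset; exact.
      rewrite memNset//=; apply: cvg_near_cst; apply: nearW => n.
      by rewrite indicE memNset// => Fx; apply: Ux; exists n.
- by move=> B oB; split; [exact: open_measurable_rV|exact: continuous_approx_open].
Qed.

Lemma continuous_approx_half (f g : 'rV[R]_d -> R) :
  continuous_approx f -> continuous_approx g ->
  continuous_approx (fun x => 2^-1 * f x + 2^-1 * g x).
Proof.
have uhalf f1 g1 : unit_valued f1 -> unit_valued g1 ->
    unit_valued (fun x => 2^-1 * f1 x + 2^-1 * g1 x).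
  move=> [mf f01] [mg g01]; split.
    by apply: measurable_funD; exact: measurable_funM.
  by move=> x; have /andP[? ?] := f01 x; have /andP[? ?] := g01 x; lra.
move=> [uf hf] [ug hg]; split; first exact: uhalf.
move=> e e0; have [h1 [uh1 ch1 Lh1]] := hf _ e0; have [h2 [uh2 ch2 Lh2]] := hg _ e0.
exists (fun x => 2^-1 * h1 x + 2^-1 * h2 x); split.
- exact: uhalf.
- have cM (k : 'rV[R]_d -> R) : continuous k -> continuous (fun x => 2^-1 * k x).
    move=> ck x; apply: (@continuousM _ _ (fun=> 2^-1) k); last exact: ck.
    exact: cst_continuous.
  by move=> x; exact: (cvgD (cM _ ch1 x) (cM _ ch2 x)).
- apply: (le_trans (@l1_dist2_le _ _ f h1 g h2 2^-1 2^-1 (uhalf _ _ uf ug)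
    (uhalf _ _ uh1 uh2) uf uh1 ug uh2 _)); last by lra.
  move=> x; rewrite (_ : _ - _ = 2^-1 * (f x - h1 x) + 2^-1 * (g x - h2 x)); last by ring.
  by rewrite (le_trans (ler_normD _ _))// !normrM ger0_norm.
Qed.

(** Binary expansion of [f]: the first digit is the indicator of [2^-1 <= f], and the remainder
    [2 f - \1_A] is again [[0, 1]]-valued. After [n] digits the uniform error is at most [2 ^- n],
    and each truncation is built by halving from approximable indicators. *)
Lemma continuous_approx_unit_valued (f : 'rV[R]_d -> R) :
  unit_valued f -> continuous_approx f.
Proof.
move=> uf.
have H n : forall f, unit_valued f ->
    exists2 g, continuous_approx g & forall x, `|f x - g x| <= 2 ^- n.
  elim: n => [|n IH] {}f {}uf.
    exists \1_set0; first exact/continuous_approx_open/open0.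
    by move=> x; rewrite expr0 invr1; apply: unit_valued_distr => //; exact: unit_valued_indic.
  pose A := [set x | 2^-1 <= f x].
  have mA : measurable A.
    rewrite -[X in measurable X]setTI (_ : A = f @^-1` `[2^-1, +oo[).
      by apply: uf.1.
    by apply/seteqP; split => x /=; rewrite in_itv/= andbT.
  pose f' x := 2 * f x - \1_A x.
  have uf' : unit_valued f'.
    split.
      apply: measurable_funB => //; apply: measurable_funM => //; exact: uf.1.
    move=> x; rewrite /f' indicE; have /andP[? ?] := uf.2 x.
    by have [h|h] := leP 2^-1 (f x); [rewrite mem_set//=; lra|rewrite memNset/=; [lra|rewrite /A/= leNgt h]].
  have [g ag hg] := IH _ uf'.
  exists (fun x => 2^-1 * \1_A x + 2^-1 * g x).
    by apply: continuous_approx_half => //; exact: continuous_approx_measurable.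
  move=> x; rewrite (_ : f x - _ = 2^-1 * (f' x - g x)); last by rewrite /f'; field.
  by rewrite normrM ger0_norm// exprS invfM ler_pM2l.
have /choice[g hg] : forall n, exists g,
    continuous_approx g /\ forall x, `|f x - g x| <= 2 ^- n.
  by move=> n; have [g] := H n f uf; exists g.
apply: (@continuous_approx_lim g) => //.
  by move=> n; have [] := hg n.
move=> x; apply/cvgrPdist_le => e e0.
have : (2 ^- n : R) @[n --> \oo] --> 0.
  by under eq_fun do rewrite -exprVn; apply: cvg_expr; rewrite ger0_norm// invf_lt1// ltr1n.
move=> /cvgrPdist_le/(_ _ e0); apply: filterS => n; rewrite sub0r normrN ger0_norm//.
by apply: le_trans; have [_] := hg n.
Qed.

Lemma le_Rintegral_of_continuous (K : R) :
  (forall h, unit_valued h -> continuous h -> \int[mu1]_x h x <= \int[mu2]_x h x + K) ->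
  forall f, unit_valued f -> \int[mu1]_x f x <= \int[mu2]_x f x + K.
Proof.
move=> H f uf; apply/ler_addgt0Pr => e e0.
have [h [uh ch]] := (continuous_approx_unit_valued uf).2 _ e0; rewrite /l1_dist2 => Lh.
have intu (mu : probability 'rV[R]_d R) g : unit_valued g -> mu.-integrable setT (EFin \o g).
  move=> [mg g01]; apply: (@integrable_bounded _ _ _ _ _ 1) => // x.
  by have /andP[? ?] := g01 x; rewrite ger0_norm.
have D (mu : probability 'rV[R]_d R) :
    `|\int[mu]_x f x - \int[mu]_x h x| <= \int[mu]_x `|f x - h x|.
  rewrite -RintegralB//; try exact: intu.
  apply: le_normr_Rintegral => //.
  exact: (integrableB measurableT (intu _ _ uf) (intu _ _ uh)).
have := D mu1; have := D mu2; have := H h uh ch.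
rewrite !ler_norml => h1 /andP[h2 h3] /andP[h4 h5]; lra.
Qed.

End continuous_approximation.

(** * Interpolation by tents *)

Section dominated_fubini.
Context d (T : measurableType d) (R : realType) (P : probability T R).
Local Notation mu := (@lebesgue_measure R).
Variables (f : R -> T -> R) (g : R -> R).
Hypothesis mf : measurable_fun setT (fun z : measurableTypeR R * T => f z.1 z.2).
Hypothesis fg : forall u t, `|f u t| <= g u.
Hypothesis ig : mu.-integrable setT (EFin \o g).

Let prod_integrable :
  (mu \x P)%E.-integrable setT (fun z : measurableTypeR R * T => (f z.1 z.2)%:E).
Proof.
apply/integrable12ltyP; first exact/measurable_EFinP.
apply: (@le_lt_trans _ _ (\int[mu]_u (g u)%:E)%E); last first.
  have /integrableP[_] := ig; apply: le_lt_trans.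
  apply: ge0_le_integral => //.
  (* The sample space is inhabited, and any point yields [0 <= g u]. *)
  - by move=> u _; rewrite lee_fin (le_trans _ (fg u point)).
  - by have /integrableP[] := ig.
  - by apply: measurableT_comp => //; have /integrableP[] := ig.
  - by move=> u _; rewrite lee_fin ler_norm.
apply: ge0_le_integral => //.
- by move=> u _; exact: integral_ge0.
- apply: (@measurable_fun_fubini_tonelli_F _ _ (measurableTypeR R) _ _ P
    (fun z => `|(f z.1 z.2)%:E|)%E) => //.
  by apply: measurableT_comp => //; exact/measurable_EFinP.
- by have /integrableP[] := ig.
- move=> u _; apply: (@le_trans _ _ (\int[P]_y (g u)%:E)%E).
    apply: ge0_le_integral => //.
    + apply: measurableT_comp => //; apply/measurable_EFinP.
      exact: (measurableT_comp mf (pair1_measurable _)).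
    + by move=> t _; rewrite lee_fin.
  by rewrite integral_cst//= probability_setT mule1.
Qed.

Let fubini_F_EFin u : (\int[P]_t (f u t)%:E = (\int[P]_t f u t)%:E)%E.
Proof.
rewrite fineK//; apply: (@integrable_fin_num _ _ _ P) => //.
apply: (@integrable_bounded _ _ _ _ _ (g u)) => //.
exact: (measurableT_comp mf (pair1_measurable _)).
Qed.

Let fubini_G_EFin t : (\int[mu]_u (f u t)%:E = (\int[mu]_u f u t)%:E)%E.
Proof.
rewrite fineK//; apply: (@integrable_fin_num _ _ _ mu) => //.
apply: (@integrable_le _ (measurableTypeR R) _ _ _ g) => //.
exact: (measurableT_comp mf (pair2_measurable _)).
Qed.

Lemma integrable_dominated_Fubini :
  mu.-integrable setT (EFin \o (fun u => \int[P]_t f u t)).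
Proof.
have := integrable_fubini_F prod_integrable; congr (_.-integrable _ _).
by apply/funext => u; rewrite /fubini_F/= fubini_F_EFin.
Qed.

Lemma dominated_Fubini :
  \int[P]_t \int[mu]_u f u t = \int[mu]_u \int[P]_t f u t.
Proof.
rewrite [LHS]/Rintegral [RHS]/Rintegral; congr fine.
under eq_integral do rewrite -fubini_G_EFin.
under [RHS]eq_integral do rewrite -fubini_F_EFin.
exact/esym/(Fubini prod_integrable).
Qed.

End dominated_fubini.

Lemma measurable_fun_bigprod d (T : measurableType d) (R : realType) (I : Type)
    (r : seq I) (Q : pred I) (f : I -> T -> R) :
  (forall i, measurable_fun setT (f i)) ->
  measurable_fun setT (fun x => \prod_(i <- r | Q i) f i x).
Proof.
move=> mf; elim: r => [|i r IH].
  by under eq_fun do rewrite big_nil; exact: measurable_cst.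
under eq_fun do rewrite big_cons.
by case: (Q i) => //; exact: measurable_funM.
Qed.

Section tensor_tent.
Variables (R : realType) (d : nat) (mu1 mu2 : probability 'rV[R]_d R).
Local Notation mu := (@lebesgue_measure R).

Definition int_diff (f : 'rV[R]_d -> R) := \int[mu1]_x f x - \int[mu2]_x f x.

(** A profile integrable on the line as soon as [s > 0]; with a product of such profiles one
    frequency can be integrated out while the other factors stay untouched. *)
Definition decay (a s t : R) := (1 + a * `|t|) `^ (- 1 - s).

Variables (A a s : R).
Hypotheses (A0 : 0 <= A) (a0 : 0 < a) (s0 : 0 < s).
Hypothesis cos_decay : forall v th,
  `|int_diff (fun x => cos (dotv v x + th))| <= A * \prod_(k < d) decay a s (v 0 k).

Lemma decay_ge0 t : 0 <= decay a s t. Proof. exact: powR_ge0. Qed.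

Lemma decay0 : decay a s 0 = 1.
Proof. by rewrite /decay normr0 mulr0 addr0 powR1. Qed.

Lemma measurable_dotv v : measurable_fun setT (dotv v : 'rV[R]_d -> R).
Proof.
rewrite /dotv; apply: measurable_sum => k; apply: measurable_funM => //.
exact: measurable_coord.
Qed.

Lemma measurable_tent : measurable_fun setT (@tent R).
Proof.
apply: measurable_maxr => //; apply: measurable_funB => //.
Qed.

Lemma tent_ge0 (x : R) : 0 <= tent x.
Proof. by rewrite /tent le_max lexx. Qed.

Lemma tent_le1 (x : R) : tent x <= 1.
Proof. by rewrite /tent ge_max ler01 gerBl normr_ge0. Qed.

Variables (N : R) (j : 'I_d -> R).
Hypothesis N0 : 0 < N.

(** The index set [S] is there for the induction of [tents_cos_bound], which removes tents one
    coordinate at a time; only the full product is used for interpolation. *)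
Definition tents (S : {set 'I_d}) (x : 'rV[R]_d) := \prod_(k in S) tent (N * x 0 k - j k).

Lemma measurable_tents S : measurable_fun setT (tents S).
Proof.
apply: measurable_fun_bigprod => k; apply: measurableT_comp; first exact: measurable_tent.
by apply: measurable_funB => //; apply: measurable_funM => //; exact: measurable_coord.
Qed.

Lemma tents_ge0 S x : 0 <= tents S x.
Proof. by apply: prodr_ge0 => k _; exact: tent_ge0. Qed.

Lemma tents_le1 S x : tents S x <= 1.
Proof. by apply: prodr_ile1 => k _; rewrite tent_ge0 tent_le1. Qed.

Lemma measurable_tents_cos S v th :
  measurable_fun setT (fun x => tents S x * cos (dotv v x + th)).
Proof.
apply: measurable_funM; first exact: measurable_tents.
apply: measurableT_comp; first exact: (continuous_measurable_fun (@continuous_cos R)).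
by apply: measurable_funD => //; exact: measurable_dotv.
Qed.

Lemma integrable_tents_cos (m : probability 'rV[R]_d R) S v th :
  m.-integrable setT (EFin \o (fun x => tents S x * cos (dotv v x + th))).
Proof.
apply: (@integrable_bounded _ _ _ _ _ 1); first exact: measurable_tents_cos.
by move=> x; rewrite normrM mulr_ile1// ?cos_max// ger0_norm ?tents_ge0// tents_le1.
Qed.

(* Inserting the cosine transform of one tent trades it for a frequency shift
   [u] in its coordinate, averaged against the Fejer kernel. *)
Lemma tents_cos_step (S : {set 'I_d}) k v th : k \notin S ->
  let vp u : 'rV[R]_d := v + \row_i (u * N *+ (i == k)) in
  let phi u := 2^-1 * (int_diff (fun x => tents S x * cos (dotv (vp u) x + (th - u * j k))) +
             int_diff (fun x => tents S x * cos (dotv (vp (- u)) x + (th + u * j k)))) in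
  mu.-integrable setT (EFin \o (fun u => fejer 1 u * phi u)) /\
  fejer_mass R * int_diff (fun x => tents (k |: S) x * cos (dotv v x + th)) =
  \int[mu]_u (fejer 1 u * phi u).
Proof.
move=> kS vp phi.
pose G u x := fejer 1 u * (tents S x *
  (2^-1 * (cos (dotv (vp u) x + (th - u * j k)) + cos (dotv (vp (- u)) x + (th + u * j k))))).
have dotE u x : dotv (vp u) x = dotv v x + u * N * x 0 k.
  rewrite /dotv /vp; under eq_bigr do rewrite !mxE mulrDl.
  rewrite big_split/=; congr (_ + _); rewrite (bigD1 k)//= eqxx mulr1n big1 ?addr0//.
  by move=> i /negbTE ->; rewrite mulr0n mul0r.
(* The mean over the shifts [u] and [- u] turns the shifted cosine into the original one times
   [cos (u * (N * x 0 k - j k))]; the kernel lives on a half line, so both signs have to be put in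
   by hand. *)
have GE u x : G u x = fejer 1 u *
    cos (u * (N * x 0 k - j k)) * (tents S x * cos (dotv v x + th)).
  rewrite /G !dotE.
  have -> : dotv v x + u * N * x 0 k + (th - u * j k) = (dotv v x + th) + u * (N * x 0 k - j k) by ring.
  have -> : dotv v x + - u * N * x 0 k + (th + u * j k) = (dotv v x + th) - u * (N * x 0 k - j k) by ring.
  by rewrite cosD cosB; field.
have mG : measurable_fun setT (fun z : measurableTypeR R * 'rV[R]_d => G z.1 z.2).
  under eq_fun do rewrite GE.
  have m1 : @measurable_fun _ _ (measurableTypeR R * 'rV[R]_d)%type R setT fst.
    exact: (@measurable_fst _ _ (measurableTypeR R) _).
  have m2 := @measurable_snd _ _ (measurableTypeR R) 'rV[R]_d.
  have mcos := continuous_measurable_fun (@continuous_cos R).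
  apply: measurable_funM; last exact: (measurableT_comp (measurable_tents_cos _ _ _) m2).
  apply: measurable_funM; first exact: (measurableT_comp (measurable_fejer 1) m1).
  apply: (measurableT_comp mcos); apply: measurable_funM => //.
  apply: measurable_funB => //; apply: measurable_funM => //.
  exact: (measurableT_comp (measurable_coord k) m2).
have Gle u x : `|G u x| <= fejer 1 u.
  rewrite GE; move: (fejer 1 u) (fejer_ge0 1 u) => F F0.
  rewrite !normrM (ger0_norm F0) -mulrA ler_piMr//.
  rewrite mulr_ile1// ?cos_max// mulr_ile1// ?cos_max//.
  by rewrite ger0_norm ?tents_ge0// tents_le1.
have intE (m : probability 'rV[R]_d R) u : \int[m]_x G u x = fejer 1 u * (2^-1 *
    (\int[m]_x (tents S x * cos (dotv (vp u) x + (th - u * j k))) +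
     \int[m]_x (tents S x * cos (dotv (vp (- u)) x + (th + u * j k))))).
  have i1 := integrable_tents_cos m S (vp u) (th - u * j k).
  have i2 := integrable_tents_cos m S (vp (- u)) (th + u * j k).
  have i3 := integrableD measurableT i1 i2.
  rewrite -RintegralD// -RintegralZl// -RintegralZl//; last first.
    exact: (integrableZl measurableT _ i3).
  by apply: eq_Rintegral => x _; rewrite /G; ring.
have phiE u : \int[mu1]_x G u x - \int[mu2]_x G u x = fejer 1 u * phi u.
  by rewrite !intE /phi /int_diff; ring.
have FI (m : probability 'rV[R]_d R) := integrable_dominated_Fubini m mG Gle (@integrable_fejer1 R).
have F (m : probability 'rV[R]_d R) := dominated_Fubini m mG Gle (@integrable_fejer1 R).
split.
  have := integrableB measurableT (FI mu1) (FI mu2); congr (_.-integrable _ _).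
  by apply/funext => u /=; rewrite -EFinB phiE.
have LE (m : probability 'rV[R]_d R) :
    fejer_mass R * \int[m]_x (tents (k |: S) x * cos (dotv v x + th)) =
    \int[mu]_u \int[m]_x G u x.
  rewrite -F -RintegralZl//; last exact: integrable_tents_cos.
  apply: eq_Rintegral => x _.
  under [RHS]eq_Rintegral do rewrite GE.
  rewrite RintegralZr//; last first.
    apply: (@integrable_le _ (measurableTypeR R) _ _ _ (fejer 1)) (@integrable_fejer1 R) => //.
      apply: measurable_funM; first exact: measurable_fejer.
      apply: (measurableT_comp (continuous_measurable_fun (@continuous_cos R))).
      exact: measurable_funM.
    move=> u; move: (fejer 1 u) (fejer_ge0 1 u) => f0 f00.
    by rewrite normrM (ger0_norm f00) ler_piMr// cos_max.
  by rewrite -tent_fejer /tents big_setU1//=; ring.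
rewrite /int_diff mulrBr !LE -RintegralB//; try exact: FI.
by apply: eq_Rintegral => u _; rewrite phiE.
Qed.

(** Induction on the size of [S]. Removing the tent at [k] puts the frequency [u * N] in a
    coordinate where [v] vanishes, so the product of decays gains exactly the factor
    [decay a s (u * N)]. Its integral over the half line is [1 / (a * s * N)], and division by
    [fejer_mass] completes the new factor. *)
Lemma tents_cos_bound (S : {set 'I_d}) (v : 'rV[R]_d) (th : R) :
  (forall i, i \in S -> v 0 i = 0) ->
  `|int_diff (fun x => tents S x * cos (dotv v x + th))| <=
  A * (fejer_mass R * a * s * N) ^- #|S| * \prod_(i < d) decay a s (v 0 i).
Proof.
elim: {S}#|S| {-2}S (erefl #|S|) v th => [|n IH] S Sn v th vS.
  move/eqP: Sn; rewrite cards_eq0 => /eqP ->.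
  rewrite cards0 expr0 invr1 mulr1; apply: le_trans (cos_decay v th).
  rewrite le_eqVlt; apply/orP; left; apply/eqP; congr (`|int_diff _|).
  by apply/funext => x; rewrite /tents big_set0 mul1r.
have /card_gt0P[k kS] : (0 < #|S|)%N by rewrite Sn.
have kS' : k \notin S :\ k by rewrite !inE eqxx.
have Sn' : #|S :\ k| = n by move: Sn; rewrite (cardsD1 k) kS => -[].
pose vp u : 'rV[R]_d := v + \row_i (u * N *+ (i == k)).
pose phi u := 2^-1 *
  (int_diff (fun x => tents (S :\ k) x * cos (dotv (vp u) x + (th - u * j k))) +
   int_diff (fun x => tents (S :\ k) x * cos (dotv (vp (- u)) x + (th + u * j k)))).
have [iphi] : mu.-integrable setT (EFin \o (fun u => fejer 1 u * phi u)) /\ _ :=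
  tents_cos_step v th kS'.
rewrite finset.setD1K// -/phi => E.
set C := A * (fejer_mass R * a * s * N) ^- n * \prod_(i < d) decay a s (v 0 i).
have m0 := fejer_mass_gt0 R.
have C0 : 0 <= C.
  rewrite mulr_ge0 ?prodr_ge0//; last by move=> i _; exact: decay_ge0.
  by rewrite mulr_ge0// invr_ge0 exprn_ge0// !mulr_ge0// ltW.
have vpE u : \prod_(i < d) decay a s (vp u 0 i) =
    decay a s (u * N) * \prod_(i < d) decay a s (v 0 i).
  rewrite (bigD1 k)//= [in RHS](bigD1 k)//= !mxE eqxx mulr1n vS// add0r decay0 mul1r.
  congr (_ * _); apply: eq_bigr => i /negbTE ik.
  by rewrite !mxE ik mulr0n addr0.
have vpS u i : i \in S :\ k -> vp u 0 i = 0.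
  by rewrite !inE => /andP[/negbTE ik iS]; rewrite !mxE ik mulr0n addr0 vS.
have phi_le u : `|phi u| <= C * decay a s (u * N).
  have h1 := IH _ Sn' (vp u) (th - u * j k) (vpS u).
  have h2 := IH _ Sn' (vp (- u)) (th + u * j k) (vpS (- u)).
  rewrite !vpE Sn' in h1 h2.
  have dN : decay a s (- u * N) = decay a s (u * N) by rewrite /decay mulNr normrN.
  rewrite dN in h2; rewrite /phi normrM ger0_norm// /C.
  by have := ler_normD (int_diff (fun x => tents (S :\ k) x * cos (dotv (vp u) x + (th - u * j k))))
    (int_diff (fun x => tents (S :\ k) x * cos (dotv (vp (- u)) x + (th + u * j k)))); lra.
(* The kernel is bounded by 1 on its half line and vanishes on the other, where the right-hand side
   is 0 as well. *)
have fphi_le u : `|fejer 1 u * phi u| <=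
    C * (\1_(`[0%R, +oo[) u * (1 + (a * N) * u) `^ (- 1 - s)).
  have := phi_le u; have := fejer1_le_indic u.
  move: (fejer 1 u) (fejer_ge0 1 u) => F F0; rewrite (normrM F) (ger0_norm F0).
  rewrite indicE mem_setE in_itv/= andbT; have [u0|u0] := leP 0 u => /= F1 p1; last first.
    have -> : F = 0 by apply/eqP; rewrite eq_le F0 F1.
    by rewrite !mul0r mulr0.
  rewrite mul1r -[leRHS]mul1r; apply: ler_pM => //; apply: (le_trans p1).
  by rewrite /decay ger0_norm ?mulr_ge0 ?(ltW N0)// (mulrC u) mulrA.
have aN0 : 0 < a * N by rewrite mulr_gt0.
rewrite -(ler_pM2l m0) -[X in X * _ <= _](ger0_norm (ltW m0)) -normrM E.
apply: (le_trans (le_normr_Rintegral measurableT iphi)).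
apply: (@le_trans _ _ (\int[mu]_u (C * (\1_(`[0%R, +oo[) u * (1 + (a * N) * u) `^ (- 1 - s))))).
  apply: le_Rintegral => //; first exact: (integrable_norm iphi).
  exact: (integrableZl measurableT C (integrable_powR_decay aN0 s0)).
rewrite RintegralZl//; last exact: integrable_powR_decay.
rewrite Rintegral_powR_decay// le_eqVlt; apply/orP; left; apply/eqP.
rewrite /C Sn exprS; set D := \prod_(i < d) _; set E' := _ ^+ n.
have E0 : E' != 0 by rewrite expf_neq0// !mulf_neq0// gt_eqF.
by field; rewrite E0 !gt_eqF.
Qed.

Lemma tents_bound :
  `|int_diff (tents finset.setT)| <= A * (fejer_mass R * a * s * N) ^- d.
Proof.
have := @tents_cos_bound finset.setT 0 0 (fun i _ => mxE _ _ _ _).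
rewrite cardsT card_ord.
under [X in _ * X]eq_bigr do rewrite mxE decay0.
rewrite big1// mulr1; apply: le_trans.
rewrite le_eqVlt; apply/orP; left; apply/eqP; congr (`|int_diff _|).
apply/funext => x; rewrite addr0 /dotv big1 ?cos0 ?mulr1// => i _.
by rewrite mxE mul0r.
Qed.

End tensor_tent.

Section tent_partition.
Variable R : realType.

Definition tent_sum (M : nat) (y : R) := \sum_(i < M.*2.+1) tent (y - (i%:R - M%:R)).

(* The second difference of [|y|] is twice the tent, so the sum telescopes. *)
Lemma tent_sumE M y : tent_sum M y =
  2^-1 * (`|y + M%:R + 1| - `|y + M%:R|) - 2^-1 * (`|y - M%:R| - `|y - M%:R - 1|).
Proof.
pose f (n : nat) : R := 2^-1 * (`|y + M%:R - n%:R| - `|y + M%:R - n%:R + 1|).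
rewrite /tent_sum (eq_bigr (fun i : 'I_(M.*2.+1) => f i.+1 - f i)); last first.
  move=> i _; rewrite tentE /f.
  have e1 : y + M%:R - i.+1%:R = y - (i%:R - M%:R) - 1 by rewrite -natr1; ring.
  have e2 : y + M%:R - i%:R = y - (i%:R - M%:R) by ring.
  have e3 : y + M%:R - i.+1%:R + 1 = y - (i%:R - M%:R) by rewrite e1; ring.
  by rewrite e3 e1 e2; lra.
rewrite -(big_mkord xpredT (fun i => f i.+1 - f i)) telescope_sumr// /f.
have e1 : y + M%:R - M.*2.+1%:R = y - M%:R - 1 by rewrite -natr1 -addnn natrD; ring.
have e2 : y + M%:R - M.*2.+1%:R + 1 = y - M%:R by rewrite e1; ring.
by rewrite e2 e1 subr0; lra.
Qed.

Lemma tent_sum_le1 M y : tent_sum M y <= 1.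
Proof.
rewrite tent_sumE.
have := ler_normD (y + M%:R) 1; have := ler_normD (y - M%:R) (- 1).
by rewrite normrN !normr1; lra.
Qed.

Lemma tent_sum_ge0 M y : 0 <= tent_sum M y.
Proof. by apply: sumr_ge0 => i _; exact: tent_ge0. Qed.

Lemma tent_sum1 (M : nat) (y : R) : `|y| <= M%:R -> tent_sum M y = 1.
Proof.
rewrite ler_norml tent_sumE => /andP[y1 y2].
rewrite (ger0_norm (_ : 0 <= y + M%:R + 1)); last lra.
rewrite (ger0_norm (_ : 0 <= y + M%:R)); last lra.
rewrite (ler0_norm (_ : y - M%:R <= 0)); last lra.
rewrite (ler0_norm (_ : y - M%:R - 1 <= 0)); lra.
Qed.

End tent_partition.

Section interpolation.
Variables (R : realType) (d : nat) (mu1 mu2 : probability 'rV[R]_d R).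
Local Notation int_diff := (int_diff mu1 mu2).

Variables (A a s : R).
Hypotheses (A0 : 0 <= A) (a0 : 0 < a) (s0 : 0 < s).
Hypothesis cos_decay : forall v th,
  `|int_diff (fun x => cos (dotv v x + th))| <= A * \prod_(k < d) decay a s (v 0 k).

Variables (r : nat) (h : 'rV[R]_d -> R).
Hypotheses (uh : unit_valued h) (ch : continuous h).

(** An integer between [- r (n + 1)] and [r (n + 1)]; divided by [n + 1] it is a node coordinate, so
    the nodes fill the cube of half-side [r] with mesh [1 / (n + 1)]. *)
Definition grid_coord n (i : nat) : R := i%:R - (r * n.+1)%:R.

Definition grid n := {ffun 'I_d -> 'I_((r * n.+1).*2.+1)}.

Definition grid_tent n (j : grid n) := tents n.+1%:R (fun k => grid_coord n (j k)) finset.setT.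

Definition interp n (x : 'rV[R]_d) : R :=
  \sum_(j : grid n) h (\row_k (grid_coord n (j k) / n.+1%:R)) * grid_tent j x.

Lemma grid_tent_sum n x :
  \sum_(j : grid n) grid_tent j x = \prod_(k < d) tent_sum (r * n.+1) (n.+1%:R * x 0 k).
Proof.
rewrite /tent_sum bigA_distr_bigA/=; apply: eq_bigr => j _.
by rewrite /grid_tent /tents; apply: eq_bigl => k; rewrite inE.
Qed.

Lemma grid_tent_sum_le1 n x : \sum_(j : grid n) grid_tent j x <= 1.
Proof.
rewrite grid_tent_sum; apply: prodr_ile1 => k _.
by rewrite tent_sum_ge0 tent_sum_le1.
Qed.

Lemma grid_tent_sum1 n (x : 'rV[R]_d) : (forall k, `|x 0 k| <= r%:R) ->
  \sum_(j : grid n) grid_tent j x = 1.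
Proof.
move=> xr; rewrite grid_tent_sum big1// => k _; apply: tent_sum1.
by rewrite normrM ger0_norm// mulrC natrM ler_wpM2r.
Qed.

Lemma unit_valued_interp n : unit_valued (interp n).
Proof.
split.
  apply: measurable_sum => j; apply: measurable_funM => //.
  exact: measurable_tents.
move=> x; apply/andP; split.
  apply: sumr_ge0 => j _; rewrite mulr_ge0 ?tents_ge0//.
  by have /andP[] := uh.2 (\row_k (grid_coord n (j k) / n.+1%:R)).
apply: le_trans (grid_tent_sum_le1 n x); apply: ler_sum => j _.
rewrite ler_piMl ?tents_ge0//.
by have /andP[] := uh.2 (\row_k (grid_coord n (j k) / n.+1%:R)).
Qed.

Lemma int_diff_sum (I : Type) (q : seq I) (c : I -> R) (f : I -> 'rV[R]_d -> R) (B : R) :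
  (forall i, unit_valued (f i)) -> (forall i, 0 <= c i <= 1) ->
  (forall i, `|int_diff (f i)| <= B) ->
  `|int_diff (fun x => \sum_(i <- q) c i * f i x)| <= (size q)%:R * B.
Proof.
move=> uf c01 fB.
have If (m : probability 'rV[R]_d R) i : m.-integrable setT (EFin \o f i).
  apply: (@integrable_bounded _ _ _ _ _ 1); first exact: (uf i).1.
  by move=> x; have /andP[? ?] := (uf i).2 x; rewrite ger0_norm.
have Icf (m : probability 'rV[R]_d R) i : m.-integrable setT (EFin \o (fun x => c i * f i x)).
  exact: (integrableZl measurableT (c i) (If m i)).
have Isum (m : probability 'rV[R]_d R) (p : seq I) :
    m.-integrable setT (EFin \o (fun x => \sum_(i <- p) c i * f i x)).
  elim: p => [|i p IH].
    under eq_fun do rewrite big_nil.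
    exact: finite_measure_integrable_cst.
  under eq_fun do rewrite big_cons.
  exact: (integrableD measurableT (Icf m i) IH).
elim: q => [|i q IH].
  rewrite /int_diff; under eq_Rintegral do rewrite big_nil.
  under [X in _ - X]eq_Rintegral do rewrite big_nil.
  by rewrite /Rintegral !integral0_eq// subrr normr0 mul0r.
rewrite /int_diff; under eq_Rintegral do rewrite big_cons.
under [X in _ - X]eq_Rintegral do rewrite big_cons.
have E (m : probability 'rV[R]_d R) : \int[m]_x (c i * f i x + \sum_(k <- q) c k * f k x) =
    c i * \int[m]_x f i x + \int[m]_x \sum_(k <- q) c k * f k x.
  by rewrite (RintegralD measurableT (Icf m i) (Isum m q)) (RintegralZl _ measurableT (If m i)).
rewrite !E opprD addrACA -mulrBr /= -natr1 mulrDl mul1r.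
apply: (le_trans (ler_normD _ _)); rewrite [leRHS]addrC lerD//.
have /andP[ci0 ci1] := c01 i.
by rewrite normrM ger0_norm// (le_trans _ (fB i))// ler_piMl.
Qed.

Lemma int_diff_interp n :
  `|int_diff (interp n)| <= A * ((r.*2.+1)%:R / (fejer_mass R * a * s)) ^+ d.
Proof.
have m0 := fejer_mass_gt0 R.
have H := @int_diff_sum _ (index_enum (grid n))
  (fun j => h (\row_k (grid_coord n (j k) / n.+1%:R))) (fun j => @grid_tent n j)
  (A * (fejer_mass R * a * s * n.+1%:R) ^- d) _ _ _.
apply: le_trans (H _ _ _) _.
- move=> j; split; first exact: measurable_tents.
  by move=> x; rewrite tents_ge0 tents_le1.
- by move=> j; exact: uh.2.
- by move=> j; apply: tents_bound.
have -> : size (index_enum (grid n)) = ((r * n.+1).*2.+1 ^ d)%N.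
  by rewrite [index_enum _]unlock -enumT -cardE card_ffun !card_ord.
rewrite mulrCA ler_wpM2l// natrX -exprVn -exprMn lerXn2r// ?nnegrE ?mulr_ge0 ?invr_ge0 ?mulr_ge0 ?(ltW m0) ?(ltW a0) ?(ltW s0)//.
rewrite [_ * n.+1%:R]mulrC invfM mulrA ler_wpM2r ?invr_ge0 ?mulr_ge0 ?(ltW m0) ?(ltW a0) ?(ltW s0)//.
(* Per coordinate, [2 r (n + 1) + 1 <= (2 r + 1) (n + 1)]: the number of nodes absorbs the inverse
   power of the mesh parameter. *)
rewrite ler_pdivrMr// -natrM ler_nat.
by rewrite mulSn -doubleMl -[ltnLHS]add0n ltn_add2r.
Qed.

(** On the cube the tents sum to 1, so the error is an average of differences [h x - h y] over nodes
    [y]; a tent that is nonzero at [x] has its node within [1 / (n + 1)] of [x]. *)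
Lemma interp_cvg (x : 'rV[R]_d) : (forall k, `|x 0 k| <= r%:R) ->
  interp n x @[n --> \oo] --> h x.
Proof.
move=> xr; apply/cvgrPdist_le => e e0.
have /(_ x)/cvgrPdist_le/(_ _ e0)/nbhs_ballP[dl /= dl0 hdl] := ch.
have [n0 hn0] : exists n0 : nat, n0.+1%:R^-1 < dl.
  by have /ltr_add_invr[n0] := dl0; rewrite add0r; exists n0.
exists n0 => // n /= n0n.
rewrite -[h x]mul1r -(grid_tent_sum1 n xr) mulr_suml /interp -sumrB.
apply: (le_trans (ler_norm_sum _ _ _)).
apply: (@le_trans _ _ (\sum_(j : grid n) e * grid_tent j x)); last first.
  by rewrite -mulr_sumr ler_piMr ?(ltW e0)// grid_tent_sum_le1.
apply: ler_sum => j _; rewrite mulrC -mulrBl normrM [X in _ * X]ger0_norm ?tents_ge0//.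
have [->|t0] := eqVneq (grid_tent j x) 0; first by rewrite !mulr0.
rewrite ler_wpM2r ?tents_ge0//; apply: hdl.
split => // i k; rewrite ord1 {i} /ball/= !mxE.
have tk : tent (n.+1%:R * x 0 k - grid_coord n (j k)) != 0.
  apply: contraNN t0 => /eqP tk; apply/eqP.
  by apply/eqP/prodf_eq0; exists k; [rewrite inE|exact/eqP].
have : `|n.+1%:R * x 0 k - grid_coord n (j k)| < 1.
  rewrite ltNge; apply: contraNN tk => tk; rewrite /tent maxEle.
  by case: ifPn => // tk'; rewrite eq_le tk' subr_le0 tk.
rewrite (_ : _ - _ = n.+1%:R * (x 0 k - grid_coord n (j k) / n.+1%:R)); last by field.
rewrite normrM ger0_norm// -ltr_pdivlMl// mulr1 => /lt_trans; apply.
by apply: le_lt_trans hn0; rewrite lef_pV2 ?posrE// ler_nat ltnS.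
Qed.

Let box := [set x : 'rV[R]_d | forall k, `|x 0 k| <= r%:R].

(** The bound of [int_diff_interp] does not depend on [n], so [n] may tend to infinity. On the box
    bounded convergence applies; off the box [h] and its interpolation differ by at most 1, which
    costs the mass of the complement under each law. *)
Lemma int_diff_interp_limit : `|int_diff h| <=
  A * ((r.*2.+1)%:R / (fejer_mass R * a * s)) ^+ d + fine (mu1 (~` box)) + fine (mu2 (~` box)).
Proof.
have mbox : measurable box by exact: measurable_box.
pose D n x := `|h x - interp n x| * \1_box x.
have uD n x : 0 <= D n x <= 1.
  have /andP[b0 b1] := (unit_valued_indic mbox).2 x.
  by rewrite mulr_ge0//= mulr_ile1//; exact: unit_valued_distr (unit_valued_interp n).
have mD n : measurable_fun setT (D n).
  apply: measurable_funM => //; first exact: measurable_distr (unit_valued_interp n).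
have ID (m : probability 'rV[R]_d R) n : m.-integrable setT (EFin \o D n).
  apply: (@integrable_bounded _ _ _ _ _ 1) => // x.
  by have /andP[? ?] := uD n x; rewrite ger0_norm.
have D0 (m : probability 'rV[R]_d R) : \int[m]_x D n x @[n --> \oo] --> (0 : R).
  rewrite [X in _ --> X](_ : _ = \int[m]_x (fun=> 0) x); last first.
    by rewrite /Rintegral integral0_eq.
  apply: (@cvg_Rintegral_bounded _ _ _ _ _ _ 1) => //.
    by move=> n x; have /andP[? ?] := uD n x; rewrite ger0_norm.
  apply: aeW => x; rewrite /D indicE; have [xb|xb] := pselect (box x); last first.
    by rewrite memNset//; under eq_fun do rewrite mulr0; exact: cvg_cst.
  have hc : `|h x - interp n x| @[n --> \oo] --> (0 : R).
    rewrite -[X in _ --> X](@normr0 _ R) -(subrr (h x)).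
    by apply: cvg_norm; apply: cvgB; [exact: cvg_cst|exact: interp_cvg].
  by rewrite mem_set//; under eq_fun do rewrite mulr1; exact: hc.
have Idist (m : probability 'rV[R]_d R) n := integrable_distr m uh (unit_valued_interp n).
have Iu (m : probability 'rV[R]_d R) g : unit_valued g -> m.-integrable setT (EFin \o g).
  move=> [mg g01]; apply: (@integrable_bounded _ _ _ _ _ 1) => // x.
  by have /andP[? ?] := g01 x; rewrite ger0_norm.
have hD (m : probability 'rV[R]_d R) n :
    `|\int[m]_x h x - \int[m]_x interp n x| <= \int[m]_x D n x + fine (m (~` box)).
  have Ic : m.-integrable setT (EFin \o (\1_(~` box) : 'rV[R]_d -> R)).
    by apply: integrable_indic; exact: measurableC.
  have Iint := unit_valued_interp n.
  rewrite -RintegralB//; try exact: Iu.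
  have -> : fine (m (~` box)) = \int[m]_x \1_(~` box) x.
    by rewrite /Rintegral integral_indic ?setIT//; exact: measurableC.
  rewrite -(RintegralD measurableT (ID m n) Ic).
  apply: le_trans (le_normr_Rintegral _ _) _ => //.
    exact: (integrableB measurableT (Iu _ _ uh) (Iu _ _ Iint)).
  apply: le_Rintegral => //; first exact: Idist.
    exact: (integrableD measurableT (ID m n) Ic).
  move=> x _; rewrite /D !indicE in_setC; case: (boolP (x \in box)) => _ /=.
    by rewrite mulr1 addr0.
  by rewrite mulr0 add0r; exact: unit_valued_distr Iint.
set C := A * _; apply/ler_addgt0Pr => e e0.
have e2 : 0 < e / 2 by rewrite divr_gt0.
have [n1 _ H1] := (@cvgrPdist_le _ _ _ _ _ _ _).1 (D0 mu1) _ e2.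
have [n2 _ H2] := (@cvgrPdist_le _ _ _ _ _ _ _).1 (D0 mu2) _ e2.
pose n := maxn n1 n2.
have := H1 n (leq_maxl _ _); have := H2 n (leq_maxr _ _).
rewrite /= !sub0r !normrN => /(le_trans (ler_norm _)) h2 /(le_trans (ler_norm _)) h1.
have := int_diff_interp n; rewrite -/C => h3.
have := hD mu1 n; have := hD mu2 n; move: h3; rewrite /int_diff !ler_norml.
by move=> /andP[? ?] /andP[? ?] /andP[? ?]; apply/andP; split; lra.
Qed.

End interpolation.

(** * Total variation and Wasserstein distances *)

Section total_variation.
Variables (R : realType) (d : nat) (mu1 mu2 : probability 'rV[R]_d R).

Lemma integrable_unit_valued (m : probability 'rV[R]_d R) g :
  unit_valued g -> m.-integrable setT (EFin \o g).
Proof.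
move=> [mg g01]; apply: (@integrable_bounded _ _ _ _ _ 1) => // x.
by have /andP[? ?] := g01 x; rewrite ger0_norm.
Qed.

(** For [f] with values in [[-1, 1]], both [(f + 1) / 2] and [(1 - f) / 2] are unit valued; the
    constant cancels between two probabilities, and undoing the halving produces the factor 2. *)
Lemma d_TV_le (K : R) : (forall g, unit_valued g -> int_diff mu1 mu2 g <= K) ->
  (d_TV mu1 mu2 <= (2 * K)%:E)%E.
Proof.
move=> H; apply: ge_ereal_sup => _ [f [mf f1] <-].
have If (m : probability 'rV[R]_d R) : m.-integrable setT (EFin \o f).
  exact: (@integrable_bounded _ _ _ _ _ 1).
have Ef (m : probability 'rV[R]_d R) : (\int[m]_x (f x)%:E = (\int[m]_x f x)%:E)%E.
  by rewrite fineK//; exact: integrable_fin_num (If m).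
rewrite !Ef -EFinB abse_EFin lee_fin.
have ug (e : R) : `|e| = 1 -> unit_valued (fun x => 2^-1 * (e * f x) + 2^-1).
  move=> e1; split.
    by apply: measurable_funD => //; apply: measurable_funM => //; exact: measurable_funM.
  move=> x; have : `|e * f x| <= 1 by rewrite normrM e1 mul1r.
  by rewrite ler_norml; lra.
have dg (e : R) : `|e| = 1 ->
    int_diff mu1 mu2 (fun x => 2^-1 * (e * f x) + 2^-1) = 2^-1 * (e * int_diff mu1 mu2 f).
  move=> e1; have Ie (m : probability 'rV[R]_d R) := integrableZl measurableT e (If m).
  have Ie2 (m : probability 'rV[R]_d R) := integrableZl measurableT 2^-1 (Ie m).
  have Rg (m : probability 'rV[R]_d R) : \int[m]_x (2^-1 * (e * f x) + 2^-1) =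
      2^-1 * (e * \int[m]_x f x) + 2^-1.
    rewrite (@RintegralD _ _ _ m setT (fun x => 2^-1 * (e * f x)) (cst 2^-1))//; last first.
      exact: finite_measure_integrable_cst.
    rewrite (RintegralZl _ _ (Ie m))// (RintegralZl _ _ (If m))// Rintegral_cst//.
    by rewrite [X in fine X](_ : _ = 1%E) ?mulr1//; exact: probability_setT.
  by rewrite /int_diff !Rg; ring.
have := H _ (ug 1 (normr1 _)); rewrite dg ?normr1//.
have := H _ (ug (-1) (normrN1 _)); rewrite dg ?normrN1// /int_diff.
by rewrite ler_norml; lra.
Qed.

End total_variation.

Section euclidean_norm.
Variables (R : realType) (d : nat).
Implicit Types x y u : 'rV[R]_d.

Lemma enorm_ge0 x : 0 <= enorm x. Proof. exact: sqrtr_ge0. Qed.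

Lemma coord_le_enorm x k : `|x 0 k| <= enorm x.
Proof.
rewrite -sqrtr_sqr ler_sqrt; last by apply: sumr_ge0 => i _; rewrite sqr_ge0.
by rewrite (bigD1 k)//= lerDl sumr_ge0// => i _; rewrite sqr_ge0.
Qed.

Lemma enorm_le_sum x : enorm x <= \sum_(k < d) `|x 0 k|.
Proof.
have s0 : 0 <= \sum_(k < d) `|x 0 k| by apply: sumr_ge0.
rewrite -[leRHS]ger0_norm// -sqrtr_sqr ler_sqrt ?sqr_ge0// expr2 mulr_suml.
apply: ler_sum => i _; rewrite -real_normK ?num_real// expr2 ler_wpM2l//.
by rewrite (bigD1 i)//= lerDl sumr_ge0.
Qed.

Lemma enormZ (c : R) x : enorm (c *: x) = `|c| * enorm x.
Proof.
rewrite /enorm -sqrtr_sqr -sqrtrM ?sqr_ge0//; congr Num.sqrt.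
by rewrite mulr_sumr; apply: eq_bigr => k _; rewrite mxE exprMn.
Qed.

Lemma measurable_enorm : measurable_fun setT (@enorm R d).
Proof.
have -> : @enorm R d = (fun y : R => y `^ 2^-1) \o (fun x : 'rV[R]_d => \sum_(k < d) x 0 k ^+ 2).
  apply/funext => x /=; rewrite powR12_sqrt//.
  by apply: sumr_ge0 => k _; exact: sqr_ge0.
apply: measurableT_comp; first exact: measurable_powR.
apply: measurable_sum => k; apply: measurable_funX; exact: measurable_coord.
Qed.

(** Coordinatewise estimate; the factor [d], compared with Cauchy-Schwarz, only affects
    constants. *)
Lemma dotv_le u x : `|dotv u x| <= d%:R * (enorm u * enorm x).
Proof.
apply: (le_trans (ler_norm_sum _ _ _)).
apply: (@le_trans _ _ (\sum_(k < d) enorm u * enorm x)); last first.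
  by rewrite sumr_const card_ord mulr_natl.
by apply: ler_sum => k _; rewrite normrM ler_pM// coord_le_enorm.
Qed.

Lemma dotvBr u x y : dotv u (x - y) = dotv u x - dotv u y.
Proof. by rewrite /dotv -sumrB; apply: eq_bigr => k _; rewrite !mxE mulrBr. Qed.

(* The factor [d] dispenses with the triangle inequality for [enorm]. *)
Lemma enorm_lossy_triangle x y : enorm y <= d%:R * (enorm x + enorm (x - y)).
Proof.
apply: (le_trans (enorm_le_sum y)).
apply: (@le_trans _ _ (\sum_(k < d) (enorm x + enorm (x - y)))); last first.
  by rewrite sumr_const card_ord mulr_natl.
apply: ler_sum => k _; rewrite -[y 0 k](subKr (x 0 k)).
apply: (le_trans (ler_normB _ _)); rewrite lerD ?coord_le_enorm//.
by have := coord_le_enorm (x - y) k; rewrite !mxE.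
Qed.

Lemma markov_box (m : probability 'rV[R]_d R) (M : R) (r : nat) : (0 < r)%N ->
  (\int[m]_x (enorm x)%:E <= M%:E)%E ->
  fine (m (~` [set x : 'rV[R]_d | forall k, `|x 0 k| <= r%:R])) <= M / r%:R.
Proof.
move=> r0 hM; rewrite ler_pdivlMr ?ltr0n// mulrC.
set B := [set _ | _]; have mB : measurable (~` B) by apply: measurableC; exact: measurable_box.
rewrite -lee_fin EFinM fineK ?fin_num_measure//; apply: le_trans hM.
have -> : m (~` B) = (\int[m]_x (\1_(~` B) x)%:E)%E by rewrite integral_indic ?setIT.
rewrite -ge0_integralZl//; last by apply/measurable_EFinP; exact: measurable_indic.
apply: ge0_le_integral => //.
- by apply/measurable_EFinP; apply: measurable_funM.
- by apply/measurable_EFinP; exact: measurable_enorm.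
move=> x _; rewrite -EFinM lee_fin indicE.
have [xB|xB] := pselect (B x); first by rewrite memNset ?mulr0 ?enorm_ge0//; apply.
rewrite mem_set// mulr1; move/existsNP: xB => [k /negP]; rewrite -ltNge => /ltW.
by move/le_trans; apply; exact: coord_le_enorm.
Qed.

Lemma measurable_enormB :
  measurable_fun setT (fun z : 'rV[R]_d * 'rV[R]_d => enorm (z.1 - z.2)).
Proof.
apply: measurableT_comp; first exact: measurable_enorm.
apply: measurable_rV => k; under eq_fun do rewrite !mxE.
by apply: measurable_funB; apply: (measurableT_comp (measurable_coord k)).
Qed.

End euclidean_norm.

(** Exchanging the two factors of a coupling preserves its cost. This lets moment bounds pass from
    [mu] back to the laws of the process. *)
Lemma le_W1_sym (R : realType) (d : nat) (mu1 mu2 : probability 'rV[R]_d R) :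
  (W1 mu2 mu1 <= W1 mu1 mu2)%E.
Proof.
apply: le_ereal_inf => _ [pi cpi <-].
have msw : measurable_fun setT (fun z : 'rV[R]_d * 'rV[R]_d => (z.2, z.1)).
  by apply: measurable_fun_pair; [exact: measurable_snd|exact: measurable_fst].
pose sw : {mfun ('rV[R]_d * 'rV[R]_d)%type >-> ('rV[R]_d * 'rV[R]_d)%type} :=
  HB.pack (fun z : 'rV[R]_d * 'rV[R]_d => (z.2, z.1)) (isMeasurableFun.Build _ _ _ _ _ msw).
exists (distribution pi sw) => [A mA|]; first by have [h1 h2] := cpi A mA.
rewrite (ge0_integral_distribution sw); first last.
- by move=> z; rewrite lee_fin enorm_ge0.
- by apply/measurable_EFinP; exact: measurable_enormB.
by apply: eq_integral => z _ /=; rewrite -[X in enorm X]opprB -scaleN1r enormZ normrN1 mul1r.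
Qed.

Section wasserstein.
Variables (R : realType) (d : nat) (mu1 mu2 : probability 'rV[R]_d R).
Variable (w : R).
Hypothesis hw : (W1 mu1 mu2 <= w%:E)%E.

Lemma W1_coupling e : 0 < e -> exists2 pi, coupling mu1 mu2 pi &
  (\int[pi]_z (enorm (z.1 - z.2))%:E <= (w + e)%:E)%E.
Proof.
move=> e0.
have : (W1 mu1 mu2 < (w + e)%:E)%E by apply: (le_lt_trans hw); rewrite lte_fin ltrDl.
by move=> /ereal_inf_lt[_ [pi cpi <-] /ltW H]; exists pi.
Qed.

Lemma coupling_integral_fst pi (f : 'rV[R]_d -> \bar R) : coupling mu1 mu2 pi ->
  measurable_fun setT f -> (forall x, 0 <= f x)%E ->
  (\int[mu1]_x f x = \int[pi]_z f z.1)%E.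
Proof.
move=> cpi mf f0.
rewrite -(@ge0_integral_pushforward _ _ _ _ _ fst _ pi setT)//.
by apply: eq_measure_integral => A mA _; have [h _] := cpi A mA; exact/esym.
Qed.

Lemma coupling_integral_snd pi (f : 'rV[R]_d -> \bar R) : coupling mu1 mu2 pi ->
  measurable_fun setT f -> (forall x, 0 <= f x)%E ->
  (\int[mu2]_x f x = \int[pi]_z f z.2)%E.
Proof.
move=> cpi mf f0.
rewrite -(@ge0_integral_pushforward _ _ _ _ _ snd _ pi setT)//.
by apply: eq_measure_integral => A mA _; have [_ h] := cpi A mA; exact/esym.
Qed.

Lemma coupling_Rintegral pi (f : 'rV[R]_d -> R) : coupling mu1 mu2 pi ->
  measurable_fun setT f -> (forall x, `|f x| <= 1) ->
  \int[mu1]_x f x = \int[pi]_z f z.1 /\ \int[mu2]_x f x = \int[pi]_z f z.2.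
Proof.
move=> cpi mf f1.
have I1 : pi.-integrable setT ((EFin \o f) \o fst).
  apply: (@integrable_bounded _ _ _ _ (f \o fst) 1) => //.
    exact: (measurableT_comp mf measurable_fst).
  by move=> x; exact: f1.
have I2 : pi.-integrable setT ((EFin \o f) \o snd).
  apply: (@integrable_bounded _ _ _ _ (f \o snd) 1) => //.
    exact: (measurableT_comp mf measurable_snd).
  by move=> x; exact: f1.
have mEf : measurable_fun setT (EFin \o f) by exact/measurable_EFinP.
split; rewrite /Rintegral; congr fine.
  rewrite -[RHS](@integral_pushforward _ _ _ _ _ fst _ pi setT (EFin \o f))//.
  by apply: eq_measure_integral => A mA _; have [h _] := cpi A mA; exact/esym.
rewrite -[RHS](@integral_pushforward _ _ _ _ _ snd _ pi setT (EFin \o f))//.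
by apply: eq_measure_integral => A mA _; have [_ h] := cpi A mA; exact/esym.
Qed.

Lemma measurable_cos_dotv (u : 'rV[R]_d) th :
  measurable_fun setT (fun x => cos (dotv u x + th)).
Proof.
apply: measurableT_comp; first exact: (continuous_measurable_fun (@continuous_cos R)).
by apply: measurable_funD => //; exact: measurable_dotv.
Qed.

Lemma W1_int_diff_cos (u : 'rV[R]_d) th :
  `|int_diff mu1 mu2 (fun x => cos (dotv u x + th))| <= d%:R * enorm u * w.
Proof.
have c0 : 0 <= d%:R * enorm u by rewrite mulr_ge0// enorm_ge0.
apply/ler_addgt0Pr => e e0.
(* The tolerance of the coupling is multiplied by [d * enorm u] below; the added 1 keeps the
   denominator positive at [u = 0]. *)
have e0' : 0 < e / (1 + d%:R * enorm u) by rewrite divr_gt0// ltr_pwDl.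
have [pi cpi hpi] := W1_coupling e0'.
have [|E1 E2] := coupling_Rintegral cpi (measurable_cos_dotv u th).
  by move=> x; exact: cos_max.
have mc (p : 'rV[R]_d * 'rV[R]_d -> 'rV[R]_d) : measurable_fun setT p ->
    measurable_fun setT (fun z => cos (dotv u (p z) + th)).
  by move=> mp; exact: (measurableT_comp (measurable_cos_dotv u th) mp).
have I1 : pi.-integrable setT (EFin \o (fun z => cos (dotv u z.1 + th))).
  by apply: (@integrable_bounded _ _ _ _ _ 1) => //; [exact: mc|move=> x; exact: cos_max].
have I2 : pi.-integrable setT (EFin \o (fun z => cos (dotv u z.2 + th))).
  by apply: (@integrable_bounded _ _ _ _ _ 1) => //; [exact: mc|move=> x; exact: cos_max].
have In : pi.-integrable setT (EFin \o (fun z => enorm (z.1 - z.2))).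
  apply/integrableP; split; first by apply/measurable_EFinP; exact: measurable_enormB.
  apply: le_lt_trans (ltry (w + e / (1 + d%:R * enorm u))); apply: le_trans hpi.
  by under eq_integral do rewrite /= ger0_norm ?enorm_ge0//.
rewrite /int_diff E1 E2 -RintegralB//.
apply: (le_trans (le_normr_Rintegral measurableT _)).
  exact: (integrableB measurableT I1 I2).
apply: (@le_trans _ _ (\int[pi]_z (d%:R * enorm u * enorm (z.1 - z.2)))).
  apply: le_Rintegral => //.
  - exact: (integrable_norm (integrableB measurableT I1 I2)).
  - exact: (integrableZl measurableT _ In).
  move=> z _; apply: (le_trans (cos_lipschitz _ _)).
  rewrite (_ : _ - _ = dotv u (z.1 - z.2)); last by rewrite dotvBr; ring.
  by rewrite -mulrA; exact: dotv_le.
rewrite RintegralZl//.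
have -> : d%:R * enorm u * w + e = d%:R * enorm u * (w + e / (1 + d%:R * enorm u)) +
    e / (1 + d%:R * enorm u).
  by field; rewrite gt_eqF// ltr_pwDl.
rewrite -[leLHS]addr0 lerD ?(ltW e0')// ler_wpM2l//.
rewrite -lee_fin fineK//; exact: integrable_fin_num In.
Qed.

(** The summand 1 is the slack of a nearly optimal coupling, and the factor [d] comes from
    [enorm_lossy_triangle]. *)
Lemma W1_first_moment (M : R) : (\int[mu1]_x (enorm x)%:E <= M%:E)%E ->
  (\int[mu2]_x (enorm x)%:E <= (d%:R * (M + w + 1))%:E)%E.
Proof.
move=> hM; have [pi cpi hpi] := W1_coupling ltr01.
have me : measurable_fun setT (EFin \o @enorm R d).
  by apply/measurable_EFinP; exact: measurable_enorm.
rewrite (coupling_integral_fst cpi me) in hM; last by move=> x; rewrite lee_fin enorm_ge0.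
rewrite (coupling_integral_snd cpi me); last by move=> x; rewrite lee_fin enorm_ge0.
have m1 : measurable_fun setT (fun z : 'rV[R]_d * 'rV[R]_d => enorm z.1).
  by apply: measurableT_comp; [exact: measurable_enorm|exact: measurable_fst].
have m2 : measurable_fun setT (fun z : 'rV[R]_d * 'rV[R]_d => enorm z.2).
  by apply: measurableT_comp; [exact: measurable_enorm|exact: measurable_snd].
apply: (@le_trans _ _ (\int[pi]_z (d%:R%:E * ((enorm z.1)%:E + (enorm (z.1 - z.2))%:E)))%E).
  apply: ge0_le_integral => //.
  - by move=> z _; rewrite lee_fin enorm_ge0.
  - exact/measurable_EFinP.
  - under eq_fun do rewrite -EFinD -EFinM.
    apply/measurable_EFinP; apply: measurable_funM => //.
    by apply: measurable_funD => //; exact: measurable_enormB.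
  - by move=> z _; rewrite -EFinD -EFinM lee_fin enorm_lossy_triangle.
rewrite ge0_integralZl//; last 2 first.
- by apply: emeasurable_funD; apply/measurable_EFinP => //; exact: measurable_enormB.
- by move=> z _; rewrite -EFinD lee_fin addr_ge0 ?enorm_ge0.
rewrite ge0_integralD//; last 4 first.
- by move=> z _; rewrite lee_fin enorm_ge0.
- exact/measurable_EFinP.
- by move=> z _; rewrite lee_fin enorm_ge0.
- by apply/measurable_EFinP; exact: measurable_enormB.
rewrite EFinM -(addrA M) EFinD; apply: lee_wpmul2l; first by rewrite lee_fin.
exact: (leeD hM hpi).
Qed.

End wasserstein.

(** * Interpolation between decay in the frequency and decay in time *)

Section decay_interpolation.
Variable R : realType.

(* Geometric interpolation [x = x^t x^(1-t)] of the two bounds, with [t] so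
   small that half of the surplus decay [g] is kept. *)
Lemma decay_interpolation (D g : R) : 0 < D -> 0 < g ->
  exists2 t, 0 < t < 1 & forall b p q x y, 0 < b -> 0 <= p -> 0 <= q -> 0 <= x -> 0 <= y ->
    x <= p * y -> x <= q * (1 + b * y) `^ (- D - g) ->
    x <= p `^ t * (q `^ (1 - t) * b `^ (- t)) * (1 + b * y) `^ (- D - g / 2).
Proof.
move=> D0 g0; have [t t01 tE] : exists2 t, 0 < t < 1 &
    t + (- D - g) * (1 - t) = - D - g / 2.
  have Dg : 0 < 2 * (D + g + 1) by lra.
  (* The equation is linear in [t]. Its first summand [t] is the price of bounding [y] to the power
     [t] by that power of [(1 + b * y) / b]. *)
  exists (g / (2 * (D + g + 1))); first by rewrite divr_gt0//= ltr_pdivrMr//; lra.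
  by field; rewrite gt_eqF//; lra.
have /andP[t0 t1] := t01.
exists t => // b p q x y b0 p0 q0 x0 y0 h1 h2.
have by1 : 0 < 1 + b * y by rewrite ltr_pwDl// mulr_ge0// ltW.
have -> : x = x `^ t * x `^ (1 - t).
  by rewrite -powRD ?subrKC ?powRr1// oner_eq0.
rewrite -tE [_ `^ (t + _)]powRD ?(gt_eqF by1) ?implybT// powRrM.
have e1 : x `^ t <= p `^ t * (b `^ (- t) * (1 + b * y) `^ t).
  apply: (@le_trans _ _ ((p * y) `^ t)).
    by apply: ge0_ler_powR; rewrite ?nnegrE ?mulr_ge0 ?(ltW t0).
  rewrite powRM// ler_wpM2l ?powR_ge0// powRN ler_pdivlMl ?powR_gt0//.
  rewrite -powRM ?(ltW b0)//; apply: ge0_ler_powR; rewrite ?nnegrE ?mulr_ge0 ?(ltW t0) ?(ltW b0) ?(ltW by1)//.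
  by rewrite lerDr.
have e2 : x `^ (1 - t) <= q `^ (1 - t) * ((1 + b * y) `^ (- D - g)) `^ (1 - t).
  rewrite -powRM ?powR_ge0//; apply: ge0_ler_powR; rewrite ?nnegrE ?mulr_ge0 ?powR_ge0//.
  by rewrite subr_ge0 ltW.
apply: (le_trans (ler_pM (powR_ge0 _ _) (powR_ge0 _ _) e1 e2)).
by rewrite le_eqVlt; apply/orP; left; apply/eqP; ring.
Qed.

(** The exponent is [d] times [- 1 - g / (2 d)], so each coordinate receives one factor, which
    increases when [enorm u] is replaced by the smaller coordinate. *)
Lemma decay_le_prod (d : nat) (b g : R) (u : 'rV[R]_d) : (0 < d)%N -> 0 < b -> 0 < g ->
  (1 + b * enorm u) `^ (- d%:R - g / 2) <=
  \prod_(k < d) decay b (g / (2 * d%:R)) (u 0 k).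
Proof.
move=> d0 b0 g0; have dR : 0 < d%:R :> R by rewrite ltr0n.
have u1 : 0 < 1 + b * enorm u by rewrite ltr_pwDl// mulr_ge0 ?enorm_ge0// ltW.
have -> : - d%:R - g / 2 = (- 1 - g / (2 * d%:R)) * d%:R by field; rewrite gt_eqF.
rewrite powRrM powR_mulrn ?powR_ge0//.
set X := _ `^ _; have -> : X ^+ d = \prod_(k < d) X by rewrite prodr_const card_ord.
rewrite {}/X; apply: ler_prod => k _.
rewrite powR_ge0/= /decay -opprD !powRN lef_pV2 ?posrE ?powR_gt0//; last first.
  by rewrite ltr_pwDl// mulr_ge0// ltW.
apply: ge0_ler_powR; rewrite ?nnegrE ?addr_ge0 ?mulr_ge0 ?divr_ge0 ?enorm_ge0 ?(ltW b0) ?(ltW g0)//.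
by rewrite lerD2l ler_wpM2l ?(ltW b0)// coord_le_enorm.
Qed.

End decay_interpolation.

(** * Independence and convergence of the linear process *)

Section independent_expectation.
Context d (Omega : measurableType d) (R : realType) (P : probability Omega R).

(** Independence on rectangles identifies the joint law of [Z] and [W] with the product of their
    laws; Tonelli gives integrability and Fubini the factorisation. *)
Lemma independent_Rintegral (Z W : {mfun Omega >-> R}) :
  (forall A B, measurable A -> measurable B ->
    P (Z @^-1` A `&` W @^-1` B) = (P (Z @^-1` A) * P (W @^-1` B))%E) ->
  P.-integrable setT (EFin \o Z) -> P.-integrable setT (EFin \o W) ->
  P.-integrable setT (EFin \o (fun w => Z w * W w)) /\
  \int[P]_w (Z w * W w) = \int[P]_w Z w * \int[P]_w W w.
Proof.
move=> ind IZ IW.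
have mZW : measurable_fun setT (fun w => (Z w, W w)) by exact: measurable_fun_pair.
pose ZW : {mfun Omega >-> (R * R)%type} :=
  HB.pack (fun w => (Z w, W w)) (isMeasurableFun.Build _ _ _ _ _ mZW).
pose m1 : probability R R := distribution P Z.
pose m2 : probability R R := distribution P W.
have prodE A : measurable A -> (m1 \x m2)%E A = distribution P ZW A.
  apply: product_measure_unique => B C mB mC.
  by rewrite /distribution /pushforward -ind.
have mz : measurable_fun setT (fun z : R * R => z.1 * z.2).
  by apply: measurable_funM; [exact: measurable_fst|exact: measurable_snd].
have J1 : m1.-integrable setT (EFin \o (id : R -> R)).
  exact: (integrable_pushforward _ _ IZ).
have J2 : m2.-integrable setT (EFin \o (id : R -> R)).
  exact: (integrable_pushforward _ _ IW).
have E1 : \int[m1]_x x = \int[P]_w Z w.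
  by rewrite /Rintegral integral_distribution.
have E2 : \int[m2]_x x = \int[P]_w W w.
  by rewrite /Rintegral integral_distribution.
have Iprod : (m1 \x m2)%E.-integrable setT (fun z : R * R => (z.1 * z.2)%:E).
  apply/integrable12ltyP; first exact/measurable_EFinP.
  rewrite (eq_integral (fun x : R => ((`|x|%R)%:E * \int[m2]_y (`|y|%R)%:E)%E)); last first.
    move=> x _; rewrite -ge0_integralZl//; last by apply/measurable_EFinP; exact: normr_measurable.
    by apply: eq_integral => y _; rewrite /= normrM EFinM.
  have /integrableP[_ K2] := J2; have /integrableP[_ K1] := J1.
  have K2' : (\int[m2]_y (`|y|%R)%:E)%E \is a fin_num by rewrite ge0_fin_numE// integral_ge0.
  rewrite -(fineK K2') ge0_integralZr//; last 2 first.
  - by apply/measurable_EFinP; exact: normr_measurable.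
  - by rewrite lee_fin fine_ge0// integral_ge0.
  apply: lte_mul_pinfty; [exact: integral_ge0| |exact: ltry].
  by rewrite ge0_fin_numE// integral_ge0.
have mZWz : measurable_fun setT (fun z : R * R => (z.1 * z.2)%:E) by exact/measurable_EFinP.
have Iprod' : P.-integrable setT (EFin \o (fun w => Z w * W w)).
  have IZW : (distribution P ZW).-integrable setT (fun z : R * R => (z.1 * z.2)%:E).
    have /integrableP[_ K] := Iprod; apply/integrableP; split => //.
    apply: le_lt_trans K; rewrite le_eqVlt; apply/orP; left; apply/eqP.
    by apply: eq_measure_integral => A mA _; apply/esym; exact: prodE.
  have /integrableP[_] := IZW; rewrite ge0_integral_distribution//; last exact: measurableT_comp.
  move=> K; apply/integrableP; split => //.
  by apply/measurable_EFinP; exact: measurable_funM.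
split => //; rewrite -E1 -E2.
transitivity (fine (\int[distribution P ZW]_z (z.1 * z.2)%:E)).
  by rewrite /Rintegral integral_distribution.
transitivity (fine (\int[(m1 \x m2)%E]_z (z.1 * z.2)%:E)).
  by congr fine; apply: eq_measure_integral => A mA _; exact/esym/prodE.
rewrite -integral12_prod_meas1// /fubini_F /=.
have E2' : (\int[m2]_y y%:E = (\int[m2]_y y)%:E)%E.
  by rewrite fineK//; exact: integrable_fin_num J2.
under eq_integral do (under eq_integral do rewrite EFinM; rewrite integralZl// E2' -EFinM).
by rewrite -[LHS]/(\int[m1]_x (x * \int[m2]_y y)) RintegralZr.
Qed.

End independent_expectation.

(** * The sigma-algebra generated by [Y] and part of the innovations *)

Section past_sigma_algebra.
Context d d1 d2 (Omega : measurableType d) (R : realType) (P : probability Omega R)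
  (T1 : measurableType d1) (T2 : measurableType d2).
Variables (Y : {mfun Omega >-> T1}) (eps : int -> {mfun Omega >-> T2}).

(** A pi-system generating the joint sigma-algebra of [Y] and the [eps i] with [i] in [S]; including
    [Y] lets the initial value belong to the past. *)
Definition cylinder (S : set int) : set (set Omega) :=
  [set C | exists A (J : {fset int}) (B : int -> set T2),
    [/\ measurable A, [set` J] `<=` S, forall i, measurable (B i) &
        C = Y @^-1` A `&` \bigcap_(i in [set` J]) (eps i @^-1` B i)]].

Local Notation GT S := (g_sigma_algebraType (cylinder S)).

Lemma cylinder_setI S : setI_closed (cylinder S).
Proof.
move=> _ _ [A [J [B [mA JS mB ->]]]] [A' [J' [B' [mA' JS' mB' ->]]]].
(* Outside its own index set each cylinder imposes no condition, so the missing sets are filled with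
   [setT]. *)
exists (A `&` A'), (J `|` J')%fset, (fun i => (if i \in J then B i else setT) `&`
  (if i \in J' then B' i else setT)).
split.
- exact: measurableI.
- by move=> i /=; rewrite in_fsetU => /orP[/JS|/JS'].
- by move=> i; apply: measurableI; case: ifP.
rewrite preimage_setI setIACA; congr (_ `&` _).
apply/seteqP; split => [w [h h'] i /= ij|w h].
  by split; case: ifPn => // iJ; [exact: h|exact: h'].
by split => i /= iJ; have [] := h i _; rewrite /= ?in_fsetU ?iJ ?orbT.
Qed.

Lemma measurable_cylinder_base S : measurable_fun setT (Y : GT S -> T1).
Proof.
move=> _ A mA; rewrite setTI; apply: sub_sigma_algebra.
exists A, fset0, (fun=> setT); split => //.
by rewrite set_fset0 bigcap_set0 setIT.
Qed.

Lemma measurable_cylinder_coord S i : S i -> measurable_fun setT (eps i : GT S -> T2).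
Proof.
move=> Si _ A mA; rewrite setTI; apply: sub_sigma_algebra.
exists setT, [fset i]%fset, (fun=> A); split => //.
  by move=> k /=; rewrite inE => /eqP ->.
by rewrite preimage_setT setTI set_fset1 bigcap_set1.
Qed.

Lemma sub_cylinder_measurable S : <<s cylinder S >> `<=` measurable.
Proof.
apply: smallest_sub; first exact: sigma_algebra_measurable.
move=> _ [A [J [B [mA JS mB ->]]]]; apply: measurableI.
  by rewrite -[X in measurable X]setTI; exact: measurable_funPT.
apply: fin_bigcap_measurable => // i _.
by rewrite -[X in measurable X]setTI; exact: measurable_funPT.
Qed.

Lemma measurable_fun_cylinder S d3 (T3 : measurableType d3) (f : Omega -> T3) :
  measurable_fun setT (f : GT S -> T3) -> measurable_fun setT f.
Proof.
move=> mf _ A mA; apply: (@sub_cylinder_measurable S); exact: (mf _ _ mA).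
Qed.

Hypothesis eps_indep : mutually_independent P eps.
Hypothesis Y_indep : independent_of_family P Y eps.

Lemma cylinder_prob A (J : {fset int}) (B : int -> set T2) :
  measurable A -> (forall i, measurable (B i)) ->
  P (Y @^-1` A `&` \bigcap_(i in [set` J]) (eps i @^-1` B i)) =
  (P (Y @^-1` A) * \prod_(i <- J) P (eps i @^-1` B i))%E.
Proof.
move=> mA mB; rewrite Y_indep//; first by rewrite eps_indep.
rewrite /sigma_of_family; set G := \bigcup_i _.
have : @measurable _ (g_sigma_algebraType G) (\bigcap_(i in [set` J]) (eps i @^-1` B i)).
  apply: fin_bigcap_measurable => // i _; apply: sub_sigma_algebra.
  by exists i => //; exists (B i) => //; rewrite setTI.
by [].
Qed.

(** Dynkin's argument. For a cylinder, intersecting with the event at [j] gives a cylinder with the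
    further index [j], and the product formula gains one factor because [j] lies outside [S]. *)
Lemma cylinder_indep S A j C : <<s cylinder S >> A -> ~ S j -> measurable C ->
  P (A `&` eps j @^-1` C) = (P A * P (eps j @^-1` C))%E.
Proof.
move=> SA Sj mC; pose Cj := eps j @^-1` C.
have mCj : measurable Cj.
  by rewrite -[X in measurable X]setTI; exact: measurable_funPT.
suff : <<s cylinder S >> `<=` [set A | measurable A /\ P (A `&` Cj) = (P A * P Cj)%E].
  by move=> /(_ _ SA)[].
apply: lambda_system_subset => //; first exact: cylinder_setI.
  split => //.
  - by split => //; rewrite setTI probability_setT mul1e.
  - move=> A1 A2 A21 [m1 E1] [m2 E2]; split; first exact: measurableD.
    have fP B : measurable B -> P B \is a fin_num by move=> mB; exact: fin_num_measure.
    have foo B : measurable B -> (P B < +oo)%E by move=> mB; rewrite ltey_eq fP.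
    have -> : (A1 `\` A2) `&` Cj = (A1 `&` Cj) `\` A2.
      by apply/seteqP; split => w; rewrite /setD/setI/=; tauto.
    have mAC := measurableI _ _ m1 mCj.
    rewrite (measureD mAC m2 (foo _ mAC)) (measureD m1 m2 (foo _ m1)) (setIidr A21).
    rewrite muleBl ?fP ?fin_num_adde_defl ?fin_numN ?fP//.
    have -> : A1 `&` Cj `&` A2 = A2 `&` Cj.
      by apply/seteqP; split => w; have := A21 w; rewrite /setI/=; tauto.
    by congr (_ - _)%E; [exact: E1|exact: E2].
  - move=> F ndF HF; have mF : measurable (\bigcup_i F i).
      by apply: bigcupT_measurable => i; exact: (HF i).1.
    split => //.
    have c1 : P (F n `&` Cj) @[n --> \oo] --> P (\bigcup_i F i `&` Cj).
      rewrite setI_bigcupl; apply: nondecreasing_cvg_mu.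
      + by move=> i; apply: measurableI => //; exact: (HF i).1.
      + by apply: bigcupT_measurable => i; apply: measurableI => //; exact: (HF i).1.
      + move=> n m nm; rewrite subsetEset; apply: setSI.
        by have := ndF _ _ nm; rewrite subsetEset.
    have c2 : (P (F n) * P Cj)%E @[n --> \oo] --> (P (\bigcup_i F i) * P Cj)%E.
      apply: cvgeZr; first by rewrite fin_num_measure.
      apply: nondecreasing_cvg_mu => //.
      by move=> i; exact: (HF i).1.
    have e : (fun n => P (F n `&` Cj)) = (fun n => (P (F n) * P Cj)%E).
      by apply/funext => n; exact: (HF n).2.
    by rewrite e in c1; exact: (cvg_unique _ c1 c2).
move=> _ [A1 [J [B [mA JS mB ->]]]]; split.
  apply: (@sub_cylinder_measurable S); apply: sub_sigma_algebra.
  by exists A1, J, B.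
have jJ : j \notin J by apply/negP => /JS.
pose B' i := if i == j then C else B i.
have -> : Y @^-1` A1 `&` \bigcap_(i in [set` J]) (eps i @^-1` B i) `&` Cj =
    Y @^-1` A1 `&` \bigcap_(i in [set` (j |` J)%fset]) (eps i @^-1` B' i).
  rewrite -setIA; congr (_ `&` _); apply/seteqP; split => [w [h1 h2] i /=|w h].
    rewrite in_fset1U /B'; case: eqP => [->//|_ /= iJ]; exact: h1.
  split => [i iJ|]; last by have := h j; rewrite /= fset1U1 /B' eqxx; exact.
  have := h i; rewrite /= in_fset1U /B' iJ orbT; case: eqP => [ij|_]; last exact.
  by move: iJ; rewrite /= ij (negbTE jJ).
have mB' i : measurable (B' i) by rewrite /B'; case: ifP.
apply: (etrans (cylinder_prob _ mA mB')).
apply: (etrans _ (congr1 (fun x => (x * P Cj)%E) (esym (cylinder_prob J mA mB)))).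
rewrite -muleA; congr (_ * _)%E.
rewrite big_fsetU1//= /B' eqxx muleC; congr (_ * _)%E.
rewrite big_seq [RHS]big_seq; apply: eq_bigr => i iJ.
by case: eqP => // ij; move: iJ; rewrite ij (negbTE jJ).
Qed.

Lemma cylinder_Rintegral S j (Z : Omega -> R) (f : T2 -> R) :
  measurable_fun setT (Z : GT S -> R) -> ~ S j -> measurable_fun setT f ->
  P.-integrable setT (EFin \o Z) -> P.-integrable setT (EFin \o (f \o eps j)) ->
  P.-integrable setT (EFin \o (fun w => Z w * f (eps j w))) /\
  \int[P]_w (Z w * f (eps j w)) = \int[P]_w Z w * \int[P]_w f (eps j w).
Proof.
move=> mZ Sj mf IZ If.
pose Zm : {mfun Omega >-> R} :=
  HB.pack Z (isMeasurableFun.Build _ _ _ _ _ (measurable_fun_cylinder mZ)).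
have mfe : measurable_fun setT (f \o eps j) by exact: measurableT_comp.
pose Wm : {mfun Omega >-> R} := HB.pack (f \o eps j) (isMeasurableFun.Build _ _ _ _ _ mfe).
apply: (@independent_Rintegral _ _ _ _ Zm Wm) => // A B mA mB.
rewrite /= comp_preimage; apply: cylinder_indep Sj _.
  by have := mZ measurableT _ mA; rewrite setTI.
by rewrite -[X in measurable X]setTI; exact: mf.
Qed.

End past_sigma_algebra.

(** * Kolmogorov's inequality and almost sure convergence of series *)

Section orthogonal_series.
Context d (Omega : measurableType d) (R : realType) (P : probability Omega R).
Variables (G : nat -> set (set Omega)) (x : nat -> Omega -> R).
Local Notation GT n := (g_sigma_algebraType (G n)).

Hypothesis sub_G : forall n, <<s G n >> `<=` measurable.
Hypothesis x_adapted : forall i n, (i < n)%N -> measurable_fun setT (x i : GT n -> R).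
Hypothesis x_sq : forall n, P.-integrable setT (EFin \o (fun w => x n w ^+ 2)).
Hypothesis x_orth : forall n (f : Omega -> R), measurable_fun setT (f : GT n -> R) ->
  P.-integrable setT (EFin \o f) ->
  P.-integrable setT (EFin \o (fun w => f w * x n w)) /\ \int[P]_w (f w * x n w) = 0.

(* The partial sums from [m] on, frozen once their modulus reaches [lam]; each
   increment is orthogonal to the past, which gives Kolmogorov's inequality. *)
Fixpoint stopped (m : nat) (lam : R) (n : nat) (w : Omega) : R :=
  if n is n'.+1 then
    stopped m lam n' w + (if `|stopped m lam n' w| < lam then x (m + n') w else 0)
  else 0.

Lemma measurable_stopped_adapted m lam n N : (m + n <= N)%N ->
  measurable_fun setT (stopped m lam n : GT N -> R).
Proof.
elim: n => [|n IH] mnN /=; first exact: measurable_cst.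
have mT : measurable_fun setT (stopped m lam n : GT N -> R).
  by apply: IH; rewrite (leq_trans _ mnN)// addnS.
apply: measurable_funD => //; apply: measurable_fun_ifT => //.
- by apply: measurable_fun_ltr => //; apply: measurableT_comp => //; exact: normr_measurable.
- by apply: x_adapted; rewrite -addnS.
Qed.

Lemma measurable_adapted n (f : Omega -> R) :
  measurable_fun setT (f : GT n -> R) -> measurable_fun setT f.
Proof. by move=> mf _ A mA; apply: (@sub_G n); exact: (mf _ _ mA). Qed.

Lemma measurable_stopped m lam n : measurable_fun setT (stopped m lam n).
Proof. by apply: (@measurable_adapted (m + n)); exact: measurable_stopped_adapted. Qed.

(** Expanding the square leaves a cross term [2 * f * x], where [f] is the stopped sum on the event
    that it is not yet frozen. There it is bounded by [lam] and measurable with respect to the past,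
    so the cross term integrates to 0. *)
Lemma stopped_sq m lam n : 0 < lam ->
  P.-integrable setT (EFin \o (fun w => stopped m lam n w ^+ 2)) /\
  \int[P]_w (stopped m lam n w ^+ 2) <= \sum_(i < n) \int[P]_w (x (m + i) w ^+ 2).
Proof.
move=> lam0; elim: n => [|n [IT IH]].
  rewrite big_ord0; split.
    under eq_fun do rewrite /= expr0n/=.
    exact: finite_measure_integrable_cst.
  by under eq_Rintegral do rewrite /= expr0n/=; rewrite Rintegral_cst// mul0r.
pose T := stopped m lam n.
pose f w := if `|T w| < lam then T w else 0.
pose g w := if `|T w| < lam then x (m + n) w ^+ 2 else 0.
have mx : measurable_fun setT (x (m + n)).
  by apply: (@measurable_adapted (m + n).+1); exact: x_adapted.
have mT := measurable_stopped m lam n.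
have mb : measurable_fun setT (fun w => `|T w| < lam).
  by apply: measurable_fun_ltr => //; apply: measurableT_comp => //; exact: normr_measurable.
have mf : measurable_fun setT (f : GT (m + n) -> R).
  have mT' := @measurable_stopped_adapted m lam n (m + n) (leqnn _).
  apply: measurable_fun_ifT => //.
  by apply: measurable_fun_ltr => //; apply: measurableT_comp => //; exact: normr_measurable.
have f_int : P.-integrable setT (EFin \o f).
  apply: (@integrable_bounded _ _ _ _ _ lam); first exact: measurable_adapted mf.
  by move=> w; rewrite /f; case: ifPn => [/ltW//|_]; rewrite normr0 ltW.
have [Ifx fx0] := x_orth mf f_int.
have Ig : P.-integrable setT (EFin \o g).
  apply: integrable_le (x_sq (m + n)).
    by apply: measurable_fun_ifT => //; exact: measurable_funX.
  by move=> w; rewrite /g; case: ifPn => _; rewrite ?normr0 ?sqr_ge0// ger0_norm ?sqr_ge0.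
have E w : stopped m lam n.+1 w ^+ 2 = T w ^+ 2 + (2 * (f w * x (m + n) w) + g w).
  by rewrite /= -/T /f /g; case: ifPn => _; ring.
have I2 := integrableZl measurableT 2 Ifx.
have I3 := integrableD measurableT I2 Ig.
split.
  have := integrableD measurableT IT I3; congr (_.-integrable _ _).
  by apply/funext => w; rewrite /comp (E w).
under eq_Rintegral do rewrite E.
rewrite (RintegralD measurableT IT I3) (RintegralD measurableT I2 Ig) (RintegralZl _ measurableT Ifx).
rewrite fx0 mulr0 add0r big_ord_recr/=; apply: lerD => //.
apply: le_Rintegral => // w _; rewrite /g; case: ifPn => // _; exact: sqr_ge0.
Qed.

(** A frozen sum keeps a modulus of at least [lam] for ever; a smaller modulus at time [n] therefore
    shows that no freezing has occurred. *)
Lemma stopped_lt m lam n w : 0 < lam -> `|stopped m lam n w| < lam ->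
  stopped m lam n w = \sum_(i < n) x (m + i) w /\
  forall k, (k <= n)%N -> `|\sum_(i < k) x (m + i) w| < lam.
Proof.
move=> lam0; elim: n => [|n IH] /=.
  by move=> _; rewrite big_ord0; split => // k; rewrite leqn0 => /eqP ->; rewrite big_ord0 normr0.
case: ifPn => [/IH[E H] h|/negP h]; last by rewrite addr0 => /h.
rewrite big_ord_recr/= -E; split => // k; rewrite leq_eqVlt => /predU1P[->|]; last first.
  by rewrite ltnS; exact: H.
by rewrite big_ord_recr/= -E.
Qed.

(** The event that some partial sum from [m] on reaches modulus [lam]. In terms of stopped sums the
    union is increasing, so its probability is a limit of Chebyshev bounds. *)
Definition excursion m lam := \bigcup_n [set w | lam <= `|stopped m lam n w|].

Lemma measurable_excursion_step m lam n : measurable [set w | lam <= `|stopped m lam n w|].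
Proof.
rewrite -[X in measurable X]setTI
  (_ : [set w | _] = (fun w => `|stopped m lam n w|) @^-1` `[lam, +oo[).
  have : measurable_fun setT (fun w => `|stopped m lam n w|).
    by apply: measurableT_comp; [exact: normr_measurable|exact: measurable_stopped].
  exact.
by apply/seteqP; split => w /=; rewrite in_itv/= andbT.
Qed.

Lemma excursion_prob m lam V : 0 < lam ->
  (forall n, \sum_(i < n) \int[P]_w (x (m + i) w ^+ 2) <= V) ->
  (P (excursion m lam) <= (V / lam ^+ 2)%:E)%E.
Proof.
move=> lam0 hV.
have c : P [set w | lam <= `|stopped m lam n w|] @[n --> \oo] --> P (excursion m lam).
  apply: nondecreasing_cvg_mu.
  - by move=> n; exact: measurable_excursion_step.
  - by apply: bigcupT_measurable => n; exact: measurable_excursion_step.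
  - apply/nondecreasing_seqP => n; rewrite subsetEset => w /= h.
    by rewrite ltNge h /= addr0.
rewrite -(cvg_lim _ c)//; apply: lime_le; first by apply/cvg_ex; eexists; exact: c.
apply: nearW => n; have [IT hT] := @stopped_sq m lam n lam0.
have mE := measurable_excursion_step m lam n.
rewrite -[leLHS]fineK ?fin_num_measure// lee_fin ler_pdivlMr ?exprn_gt0//.
apply: le_trans (le_trans hT (hV n)).
have -> : fine (P [set w | lam <= `|stopped m lam n w|]) =
    \int[P]_w \1_[set w | lam <= `|stopped m lam n w|] w.
  by rewrite /Rintegral integral_indic// setIT.
have I1 : P.-integrable setT (EFin \o \1_[set w | lam <= `|stopped m lam n w|]).
  exact: integrable_indic.
rewrite -RintegralZr//; apply: le_Rintegral => //.
  exact: (integrableZr measurableT (lam ^+ 2) I1).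
move=> w _; rewrite indicE; have [h|h] := boolP (lam <= `|stopped m lam n w|).
  rewrite mem_set// mul1r -[leRHS]real_normK ?num_real// lerXn2r// nnegrE.
  exact: ltW.
by rewrite memNset ?mul0r ?sqr_ge0//=; exact/negP.
Qed.

(** The tails of the series of second moments are small, so for each threshold the excursions beyond
    every [m] form a null set. Off these countably many null sets the partial sums are Cauchy. *)
Theorem orthogonal_series_cvg :
  cvgn (series (fun n => \int[P]_w (x n w ^+ 2))) ->
  {ae P, forall w, cvgn (series (fun n => x n w))}.
Proof.
move=> cs.
have sum_shift (u : nat -> R) (m n : nat) :
    series u (m + n)%N - series u m = \sum_(i < n) u (m + i)%N.
  elim: n => [|n IH]; first by rewrite addn0 subrr big_ord0.
  by rewrite big_ord_recr/= -IH addnS /series/= big_nat_recr//= addrAC.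
have tail e : 0 < e -> exists m, forall n, \sum_(i < n) \int[P]_w (x (m + i) w ^+ 2) <= e.
  move=> e0; have /cvgrPdist_le/(_ _ e0)[m _ /(_ m (leqnn _))/= hm] := cs.
  exists m => n; rewrite -(sum_shift (fun n => \int[P]_w (x n w ^+ 2))).
  apply: le_trans (le_trans (ler_norm _) hm); rewrite lerB//.
  apply: nondecreasing_cvgn_le => //.
  by apply: nondecreasing_series => k _ _; apply: Rintegral_ge0 => w _; exact: sqr_ge0.
pose N p := \bigcap_m excursion m (p.+1%:R^-1 : R).
have mexc m lam : measurable (excursion m lam).
  by apply: bigcupT_measurable => n; exact: measurable_excursion_step.
have mN p : measurable (N p) by apply: bigcap_measurableType => m _; exact: mexc.
have N0 p : P (N p) = 0%E.
  apply/eqP; rewrite -measure_le0; apply/lee_addgt0Pr => e e0; rewrite add0e.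
  (* The square of the threshold cancels the denominator in [excursion_prob]. *)
  have e1 : 0 < e * p.+1%:R^-1 ^+ 2 :> R by rewrite mulr_gt0// exprn_gt0// invr_gt0.
  have [m hm] := tail _ e1.
  apply: (@le_trans _ _ (P (excursion m p.+1%:R^-1))).
    by apply: le_measure; rewrite ?inE//; exact: bigcap_inf.
  have p0 : 0 < p.+1%:R^-1 :> R by rewrite invr_gt0.
  have := excursion_prob p0 hm.
  by rewrite mulfK// gt_eqF// exprn_gt0.
have : P.-negligible (\bigcup_p N p).
  by apply: negligible_bigcup => p; exists (N p); split; [exact: mN|exact: N0|exact: subset_refl].
apply: negligibleS => w /= ncv; apply: contrapT => nN; apply: ncv.
apply: cauchy_cvg; apply: cauchy_exP => e e0.
have [p hp] : exists p : nat, p.+1%:R^-1 < e.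
  by have /ltr_add_invr[p] := e0; rewrite add0r; exists p.
have [m hm] : exists m, ~ excursion m p.+1%:R^-1 w.
  by apply: contrapT => /forallNP h; apply: nN; exists p => // m _; exact: contrapT (h m).
have p0 : 0 < p.+1%:R^-1 :> R by rewrite invr_gt0.
exists (series (fun n => x n w) m); exists m => // n /= mn.
rewrite /ball/= distrC (lt_trans _ hp)//.
have [|_ /(_ (n - m)%N (leqnn _))] := @stopped_lt m p.+1%:R^-1 (n - m) w p0.
  by rewrite ltNge; apply/negP => h; apply: hm; exists (n - m)%N.
by rewrite -(sum_shift (fun n => x n w)) subnKC.
Qed.

End orthogonal_series.

Section identical_distribution.
Context d (Omega : measurableType d) (R : realType) (P : probability Omega R).
Context (I : Type) d' (T : measurableType d') (eps : I -> {mfun Omega >-> T}).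
Hypothesis eps_id : identically_distributed P eps.

Lemma identically_distributed_ge0_integral i j (f : T -> \bar R) :
  measurable_fun setT f -> (forall x, 0 <= f x)%E ->
  (\int[P]_w f (eps i w) = \int[P]_w f (eps j w))%E.
Proof.
move=> mf f0; rewrite -[LHS](ge0_integral_distribution (eps i) mf f0).
rewrite -[RHS](ge0_integral_distribution (eps j) mf f0).
by apply: eq_measure_integral => A mA _; exact: eps_id.
Qed.

Lemma identically_distributed_Rintegral i j (f : T -> R) :
  measurable_fun setT f -> P.-integrable setT (EFin \o (f \o eps i)) ->
  P.-integrable setT (EFin \o (f \o eps j)) ->
  \int[P]_w f (eps i w) = \int[P]_w f (eps j w).
Proof.
move=> mf fi fj; rewrite /Rintegral; congr fine.
have mf' : measurable_fun setT (EFin \o f) by exact/measurable_EFinP.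
rewrite -[LHS](integral_distribution mf' fi) -[RHS](integral_distribution mf' fj).
by apply: eq_measure_integral => A mA _; exact: eps_id.
Qed.

End identical_distribution.

Lemma cvg_rV (R : realType) d (u : nat -> 'rV[R]_d) (l : 'rV[R]_d) :
  (forall k, u n 0 k @[n --> \oo] --> l 0 k) -> u n @[n --> \oo] --> l.
Proof.
move=> h; apply/cvg_mx_entourageP => A eA.
have : \forall n \near \oo, forall j, A (l 0 j, u n 0 j).
  by apply: filter_forall => k; have /cvg_entourageP := h k; exact.
by apply: filterS => n hn i j; rewrite inE (ord1 i).
Qed.

Section linear_process_versions.
Context dO (Omega : measurableType dO) (R : realType) (d : nat).
Variables (Y : {mfun Omega >-> 'rV[R]_d}) (eps : int -> {mfun Omega >-> 'rV[R]_d}).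

Definition coord_term (b : nat -> R) (n : int) (k : 'I_d) (j : nat) (w : Omega) : R :=
  b j * eps (n - j%:Z) w 0 k.

Definition converges (b : nat -> R) (n : int) (w : Omega) :=
  forall k, cvgn (series (fun j => coord_term b n k j w)).

Lemma converges_linear_process b n w : converges b n w ->
  linear_process b eps n w = \row_k limn (series (fun j => coord_term b n k j w)).
Proof.
move=> cv; rewrite /linear_process; set u := series (fun j => b j *: _); set l := \row_k _.
suff ul : u N @[N --> \oo] --> l.
  have ulim : u N @[N --> \oo] --> limn u by apply/cvg_ex; exists l.
  have uk k x : u N @[N --> \oo] --> x -> u N 0 k @[N --> \oo] --> (x : 'rV[R]_d) 0 k.
    by move=> ux; exact: (cvg_comp _ _ ux (@coord_continuous _ _ _ 0 k _)).
  by apply/rowP => k; exact: (cvg_unique _ (uk k _ ulim) (uk k _ ul)).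
apply: cvg_rV => k; rewrite mxE.
suff -> : (fun N => series (fun j => b j *: eps (n - j%:Z) w) N 0 k) =
  series (fun j => coord_term b n k j w) by exact: cv.
by apply/funext => N; rewrite /series/= summxE; apply: eq_bigr => j _; rewrite mxE.
Qed.

Lemma series_coord_shift b n k w N :
  series (fun j => coord_term b n k j w) (N + 1)%N =
  coord_term b n k 0 w + series (fun j => coord_term (fun j => b j.+1) (n - 1) k j w) N.
Proof.
rewrite addn1 /series/= big_nat_recl//; congr (_ + _); apply: eq_bigr => j _.
by rewrite /coord_term; congr (b _ * eps _ w 0 k); rewrite intS; ring.
Qed.

Lemma converges_shift b n w : converges b n w -> converges (fun j => b j.+1) (n - 1) w.
Proof.
move=> cv k.
have /cvg_ex[l] := cv k; rewrite -(cvg_shiftn 1) => h.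
apply/cvg_ex; exists (l - coord_term b n k 0 w).
have -> : series (fun j => coord_term (fun j => b j.+1) (n - 1) k j w) =
    (fun N => series (fun j => coord_term b n k j w) (N + 1)%N - coord_term b n k 0 w).
  apply/funext => N; by rewrite series_coord_shift addrAC subrr add0r.
by apply: cvgB => //; exact: cvg_cst.
Qed.

Lemma linear_process_recl b n w : converges b n w ->
  linear_process b eps n w =
    b 0%N *: eps n w + linear_process (fun j => b j.+1) eps (n - 1) w.
Proof.
move=> cv; have cv' := converges_shift cv.
rewrite !converges_linear_process//; apply/rowP => k; rewrite !mxE.
apply: cvg_lim => //.
rewrite -(cvg_shiftn 1).
under eq_fun do rewrite series_coord_shift {1}/coord_term subr0.
by apply: cvgD; [exact: cvg_cst|exact: cv'].
Qed.

(* [limn_esup] is measurable for every sigma-algebra that makes the terms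
   measurable, without convergence; [limn] is not known to be. *)
Definition linear_process_version (b : nat -> R) (n : int) (w : Omega) : 'rV[R]_d :=
  \row_k fine (limn_esup (fun N => (series (fun j => coord_term b n k j w) N)%:E)).

Lemma linear_process_versionE b n w : converges b n w ->
  linear_process_version b n w = linear_process b eps n w.
Proof.
move=> cv; rewrite converges_linear_process//; apply/rowP => k; rewrite !mxE.
have h : (series (fun j => coord_term b n k j w) N)%:E @[N --> \oo] -->
    (limn (series (fun j => coord_term b n k j w)))%:E.
  by apply: cvg_EFin; [exact: nearW|exact: cv].
by rewrite (cvg_limn_einf_sup h).
Qed.

Local Notation GT S := (g_sigma_algebraType (cylinder Y eps S)).

Lemma measurable_coord_term S b n k j : S (n - j%:Z) ->
  measurable_fun setT (coord_term b n k j : GT S -> R).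
Proof.
move=> Sj; apply: measurable_funM => //.
by apply: (measurableT_comp (measurable_coord k)); exact: measurable_cylinder_coord.
Qed.

Lemma measurable_linear_process_version (S : set int) b n : (forall j : nat, S (n - j%:Z)) ->
  measurable_fun setT (linear_process_version b n : GT S -> 'rV[R]_d).
Proof.
move=> Sj; apply: measurable_rV => k.
under eq_fun do rewrite mxE.
apply: (measurableT_comp (fine_measurable measurableT)).
apply: measurable_fun_limn_esup => N; apply/measurable_EFinP.
by apply: measurable_sum => j; exact: measurable_coord_term.
Qed.

End linear_process_versions.

Section convergence.
Context dO (Omega : measurableType dO) (R : realType) (P : probability Omega R) (d : nat).
Variables (Y : {mfun Omega >-> 'rV[R]_d}) (eps : int -> {mfun Omega >-> 'rV[R]_d}).
Hypothesis eps_indep : mutually_independent P eps.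
Hypothesis eps_id : identically_distributed P eps.
Hypothesis eps_int : forall i, integrable_rv P (eps i).
Hypothesis Y_indep : independent_of_family P Y eps.

Lemma measurable_coord_eps i k : measurable_fun setT (fun w => eps i w 0 k).
Proof. by apply: (measurableT_comp (measurable_coord k)). Qed.

Lemma integrable_coord i k : P.-integrable setT (EFin \o (fun w => eps i w 0 k)).
Proof.
apply: (@integrable_le _ _ _ _ _ (fun w => enorm (eps i w))) => //.
- exact: measurable_coord_eps.
- by move=> w; exact: coord_le_enorm.
- exact: eps_int.
Qed.

(** By Tonelli the expectation of the sum of absolute values is the sum of [|b j|] times one common
    first moment; it is finite, so the series converges absolutely almost surely. *)
Lemma summable_converges (b : nat -> R) n : cvgn (series (fun j => `|b j|)) ->
  {ae P, forall w, converges eps b n w}.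
Proof.
move=> cb; apply: filter_forall => k.
pose f j w := (`|coord_term eps b n k j w|)%:E.
have f0 j w : (0 <= f j w)%E by rewrite lee_fin.
have mc i : measurable_fun setT (fun w => `|eps i w 0 k|%:E).
  by apply/measurable_EFinP/measurableT_comp => //; exact: measurable_coord_eps.
have mf j : measurable_fun setT (f j).
  apply/measurable_EFinP/measurableT_comp => //.
  by apply: measurable_funM => //; exact: measurable_coord_eps.
pose m := (\int[P]_w `|eps n w 0 k|%:E)%E.
have mfin : m \is a fin_num.
  have /integrableP[_ h] := integrable_coord n k.
  by rewrite ge0_fin_numE// integral_ge0.
have If j : (\int[P]_w f j w = `|b j|%:E * m)%E.
  under eq_integral do rewrite /f normrM EFinM.
  rewrite ge0_integralZl//; congr (_ * _)%E.
  apply: (identically_distributed_ge0_integral eps_id _ n (f := fun x => `|x 0 k|%:E)) => //.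
  by apply/measurable_EFinP/measurableT_comp => //; exact: measurable_coord.
have fin : (\int[P]_w \sum_(0 <= j <oo) f j w < +oo)%E.
  rewrite integral_nneseries//.
  apply: (@le_lt_trans _ _ (limn (series (fun j => `|b j|)) * fine m)%:E); last by rewrite ltry.
  apply: lime_le; first by apply: is_cvg_nneseries => j _ _; apply: integral_ge0 => w _.
  apply: nearW => N; under eq_bigr do rewrite If -(fineK mfin) -EFinM.
  rewrite sumEFin lee_fin -mulr_suml ler_wpM2r//.
    by apply: fine_ge0; exact: integral_ge0.
  apply: (nondecreasing_cvgn_le _ cb N).
  by apply: nondecreasing_series.
have mS : measurable_fun setT (fun w => \sum_(0 <= j <oo) f j w)%E.
  by apply: ge0_emeasurable_sum.
have /integrable_ae : P.-integrable setT (fun w => \sum_(0 <= j <oo) f j w)%E.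
  apply/integrableP; split => //.
  under eq_integral do rewrite gee0_abs ?nneseries_ge0//.
  exact: fin.
move=> /(_ measurableT); apply: filterS => w /(_ I) wfin.
apply: normed_cvg; apply: nondecreasing_is_cvgn.
  by apply: nondecreasing_series => j _ _; exact: normr_ge0.
exists (fine (\sum_(0 <= j <oo) f j w)%E) => _ [N _ <-].
rewrite -lee_fin fineK// /series/= -sumEFin.
exact: nneseries_lim_ge.
Qed.

Lemma integrable_coord_sq i k : ('E_P[fun w => (enorm (eps 0 w) ^+ 2)%R] < +oo)%E ->
  P.-integrable setT (EFin \o (fun w => eps i w 0 k ^+ 2)).
Proof.
move=> h; have mc : measurable_fun setT (fun x : 'rV[R]_d => x 0 k ^+ 2).
  by apply: measurable_funX; exact: measurable_coord.
apply/integrableP; split.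
  by apply/measurable_EFinP/measurable_funX; exact: measurable_coord_eps.
under eq_integral do rewrite /= ger0_norm ?sqr_ge0//.
rewrite (identically_distributed_ge0_integral eps_id i 0 (f := fun x => (x 0 k ^+ 2)%:E))//; first last.
- by move=> x; rewrite lee_fin sqr_ge0.
- exact/measurable_EFinP.
apply: le_lt_trans h; rewrite unlock; apply: ge0_le_integral => //.
- by move=> w _; rewrite lee_fin sqr_ge0.
- by apply/measurable_EFinP; apply: measurable_funX; exact: measurable_coord_eps.
- apply/measurable_EFinP; apply: measurable_funX.
  by apply: (measurableT_comp (@measurable_enorm _ _)).
- move=> w _; rewrite lee_fin -[leLHS]real_normK ?num_real// lerXn2r ?nnegrE ?enorm_ge0//.
  exact: coord_le_enorm.
Qed.

Lemma square_summable_converges (b : nat -> R) n : vexpectation P (eps 0) = 0 ->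
  ('E_P[fun w => (enorm (eps 0 w) ^+ 2)%R] < +oo)%E ->
  cvgn (series (fun j => b j ^+ 2)) ->
  {ae P, forall w, converges eps b n w}.
Proof.
move=> mean0 sq0 cb; apply: filter_forall => k.
have mean i : \int[P]_w eps i w 0 k = 0.
  have := congr1 (fun x : 'rV[R]_d => x 0 k) mean0; rewrite !mxE unlock => <-.
  apply: (identically_distributed_Rintegral eps_id (f := fun x => x 0 k)).
  - exact: measurable_coord.
  - exact: integrable_coord.
  - exact: integrable_coord.
(* Time runs backwards along the series: its [j]-th term involves [eps (n - j)], so what precedes
   the term [m] is generated by innovations with index above [n - m]. *)
pose G m := cylinder Y eps [set i | n - m%:Z < i].
have xsqE j w : coord_term eps b n k j w ^+ 2 = b j ^+ 2 * eps (n - j%:Z) w 0 k ^+ 2.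
  by rewrite exprMn.
apply: (@orthogonal_series_cvg _ _ _ P G (coord_term eps b n k)).
- by move=> m; exact: sub_cylinder_measurable.
- move=> i m im; apply: measurable_coord_term => /=.
  by rewrite ltrD2l ltrN2 ltz_nat.
- move=> m; under eq_fun do rewrite /= xsqE.
  have := integrableZl measurableT (b m ^+ 2) (integrable_coord_sq (n - m%:Z) k sq0).
  by apply: eq_integrable => // w _.
- move=> m f mf If.
  have mbk : measurable_fun setT (fun x : 'rV[R]_d => b m * x 0 k).
    by apply: measurable_funM => //; exact: measurable_coord.
  have Ib : P.-integrable setT (EFin \o (fun w => b m * eps (n - m%:Z) w 0 k)).
    have := integrableZl measurableT (b m) (integrable_coord (n - m%:Z) k).
    by apply: eq_integrable => // w _.
  have nS : ~ [set i : int | n - m%:Z < i] (n - m%:Z) by rewrite /= ltxx.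
  have [h1 h2] := cylinder_Rintegral eps_indep Y_indep mf nS mbk If Ib.
  split => //; rewrite h2 RintegralZl//; last exact: integrable_coord.
  by rewrite mean !mulr0.
have -> : (fun j => \int[P]_w coord_term eps b n k j w ^+ 2) =
    (\int[P]_w (eps 0 w 0 k ^+ 2)) *: (fun j => b j ^+ 2).
  apply/funext => j; rewrite -[RHS]/(_ * _) mulrC; under eq_Rintegral do rewrite xsqE.
  rewrite RintegralZl//; last exact: integrable_coord_sq.
  congr (_ * _); apply: (identically_distributed_Rintegral eps_id (f := fun x => x 0 k ^+ 2)).
  - by apply: measurable_funX; exact: measurable_coord.
  - exact: integrable_coord_sq.
  - exact: integrable_coord_sq.
exact: is_cvg_seriesZ.
Qed.

End convergence.

Lemma dotvDr (R : realType) d (u x y : 'rV[R]_d) : dotv u (x + y) = dotv u x + dotv u y.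
Proof. by rewrite /dotv -big_split/=; apply: eq_bigr => k _; rewrite mxE mulrDr. Qed.

Lemma dotvZl (R : realType) d (c : R) (u x : 'rV[R]_d) : dotv (c *: u) x = dotv u (c *: x).
Proof. by rewrite /dotv; apply: eq_bigr => k _; rewrite !mxE; ring. Qed.

(** * The recursion *)

Section process.
Context dO (Omega : measurableType dO) (R : realType) (P : probability Omega R) (d : nat).
Variables (eps : int -> {mfun Omega >-> 'rV[R]_d}) (b : nat -> R)
  (nu : 'rV[R]_d -> 'rV[R]_d) (X : nat -> {mfun Omega >-> 'rV[R]_d}).
Hypothesis nu_meas : measurable_fun setT nu.
Hypothesis conv : forall n, {ae P, forall w, converges eps b n w}.
Hypothesis X_rec : forall n : nat,
  {ae P, forall w, X n.+1 w = nu (X n w) + linear_process b eps n.+1%:Z w}.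

Local Notation GT S := (g_sigma_algebraType (cylinder (X 0%N) eps S)).

(** [X n] obeys the recursion only almost surely and need not be measurable for the uncompleted
    sigma-algebra of the past; this version is, and it equals [X n] almost surely. *)
Fixpoint process_version (n : nat) (w : Omega) : 'rV[R]_d :=
  if n is n'.+1 then nu (process_version n' w) + linear_process_version eps b n w
  else X 0%N w.

Lemma measurable_rVD d0 (T : measurableType d0) (f g : T -> 'rV[R]_d) :
  measurable_fun setT f -> measurable_fun setT g -> measurable_fun setT (fun t => f t + g t).
Proof.
move=> mf mg; apply: measurable_rV => k; under eq_fun do rewrite mxE.
by apply: measurable_funD; apply: (measurableT_comp (measurable_coord k)).
Qed.

Lemma measurable_process_version (N : int) n : n%:Z <= N ->
  measurable_fun setT (process_version n : GT [set i | i <= N] -> 'rV[R]_d).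
Proof.
elim: n => [|n IH] nN /=; first exact: measurable_cylinder_base.
apply: measurable_rVD.
  apply: measurableT_comp => //; apply: IH.
  by rewrite (le_trans _ nN)// lez_nat.
apply: measurable_linear_process_version => j /=.
by rewrite (le_trans _ nN)// gerBl.
Qed.

Lemma process_versionE n : {ae P, forall w, X n w = process_version n w}.
Proof.
elim: n => [|n IH]; first exact: aeW.
have := X_rec n; have := conv n.+1%:Z; move: IH.
by apply: filterS3 => w IH cv ->/=; rewrite IH linear_process_versionE.
Qed.

Lemma process_decomposition (n : nat) : exists Y : Omega -> 'rV[R]_d,
  measurable_fun setT (Y : GT [set i | i <= n%:Z] -> 'rV[R]_d) /\
  {ae P, forall w, X n.+1 w = Y w + b 0%N *: eps n.+1%:Z w}.
Proof.
(* Splitting off the term [j = 0] leaves the linear process with shifted coefficients at time [n],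
   which involves only [eps i] with [i <= n]. *)
exists (fun w => nu (process_version n w) +
  linear_process_version eps (fun j => b j.+1) n%:Z w); split.
  apply: measurable_rVD.
    by apply: measurableT_comp => //; exact: measurable_process_version.
  by apply: measurable_linear_process_version => j /=; rewrite gerBl.
have := X_rec n; have := conv n.+1%:Z; have := process_versionE n.
apply: filterS3 => w En cv ->; have cv' := converges_shift cv.
have n1 : n.+1%:Z - 1 = n by rewrite intS addrAC subrr add0r.
rewrite n1 in cv'.
by rewrite En linear_process_versionE// linear_process_recl// n1 addrAC addrA.
Qed.

Hypothesis eps_indep : mutually_independent P eps.
Hypothesis eps_id : identically_distributed P eps.
Hypothesis X0_indep : independent_of_family P (X 0%N) eps.

(** The addition formula splits the cosine into two products of a bounded function of the past and a
    cosine or sine of the innovation. Each product integrates to at most the modulus of the real or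
    imaginary part of the characteristic function, whence the factor 2. *)
Lemma process_cos_le_char_fun (n : nat) (u : 'rV[R]_d) th :
  `|\int[P]_w cos (dotv u (X n.+1 w) + th)| <=
    2 * Normc.normc (char_fun P (eps 0) (b 0%N *: u)).
Proof.
have [Y [mY XE]] := process_decomposition n.
set S := [set i : int | i <= n%:Z] in mY.
have nS : ~ S n.+1%:Z by rewrite /S /= lez_nat ltnn.
pose v := b 0%N *: u.
have cosb (t : R) : `|cos t| <= 1 by rewrite ler_norml cos_geN1 cos_le1.
have sinb (t : R) : `|sin t| <= 1 by rewrite ler_norml sin_geN1 sin_le1.
have mdot (f : R -> R) : continuous f -> measurable_fun setT (fun x : 'rV[R]_d => f (dotv v x)).
  move=> cf; apply: (measurableT_comp (continuous_measurable_fun cf)).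
  exact: measurable_dotv.
have mdotY (f : R -> R) : continuous f ->
    measurable_fun setT ((fun w => f (dotv u (Y w) + th)) : GT S -> R).
  move=> cf; apply: (measurableT_comp (continuous_measurable_fun cf)).
  apply: measurable_funD => //.
  exact: (measurableT_comp (measurable_dotv u)).
have Ib (f : Omega -> R) : measurable_fun setT f -> (forall w, `|f w| <= 1) ->
    P.-integrable setT (EFin \o f) by move=> mf f1; exact: (@integrable_bounded _ _ _ _ _ 1).
have key (f g : R -> R) : continuous f -> continuous g ->
    (forall t, `|f t| <= 1) -> (forall t, `|g t| <= 1) ->
    P.-integrable setT (EFin \o (fun w => f (dotv u (Y w) + th) * g (dotv v (eps n.+1%:Z w)))) /\
    `|\int[P]_w (f (dotv u (Y w) + th) * g (dotv v (eps n.+1%:Z w)))| <=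
    `|\int[P]_w g (dotv v (eps 0 w))|.
  move=> cf cg f1 g1.
  have IY : P.-integrable setT (EFin \o (fun w => f (dotv u (Y w) + th))).
    apply: Ib => //; exact: (measurable_fun_cylinder (mdotY _ cf)).
  have Ie i : P.-integrable setT (EFin \o ((fun x => g (dotv v x)) \o eps i)).
    exact: Ib (measurableT_comp (mdot _ cg) (measurable_funPT _)) (fun w => g1 _).
  have [h1 h2] := cylinder_Rintegral eps_indep X0_indep (mdotY _ cf) nS (mdot _ cg) IY (Ie _).
  split => //; rewrite h2 normrM.
  rewrite (identically_distributed_Rintegral eps_id (j := 0) (f := fun x => g (dotv v x)))//; last exact: mdot.
  rewrite ler_piMl//.
  apply: (@le_trans _ _ (\int[P]_w `|f (dotv u (Y w) + th)|)); first exact: le_normr_Rintegral.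
  apply: (@le_trans _ _ (\int[P]_w 1)).
    apply: le_Rintegral => //; first exact: integrable_norm.
    by apply: Ib => // w; rewrite normr1.
  by rewrite Rintegral_cst// mul1r; rewrite [X in fine X](_ : _ = 1%E)//; exact: probability_setT.
have [Ic cc] := key _ _ (@continuous_cos R) (@continuous_cos R) cosb cosb.
have [Is ss] := key _ _ (@continuous_sin R) (@continuous_sin R) sinb sinb.
have -> : \int[P]_w cos (dotv u (X n.+1 w) + th) =
   \int[P]_w (cos (dotv u (Y w) + th) * cos (dotv v (eps n.+1%:Z w))
              - sin (dotv u (Y w) + th) * sin (dotv v (eps n.+1%:Z w))).
  rewrite /Rintegral; congr fine; apply: ae_eq_integral => //.
  - apply/measurable_EFinP.
    by apply: (measurableT_comp (measurable_cos_dotv u th)).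
  - by apply: measurable_int (integrableB measurableT Ic Is).
  - move: XE; apply: filterS => w -> _; rewrite -cosD; congr (cos _)%:E.
    by rewrite dotvDr -dotvZl addrAC.
rewrite RintegralB// (le_trans (ler_normB _ _))// mulr_natl mulr2n.
have chE : char_fun P (eps 0) v =
    (\int[P]_w cos (dotv v (eps 0 w)) +i* \int[P]_w sin (dotv v (eps 0 w)))%C.
  by rewrite /char_fun /cexpectation unlock.
rewrite chE /= in cc ss *; apply: lerD.
  by rewrite (le_trans cc)// -sqrtr_sqr ler_wsqrtr// lerDl sqr_ge0.
by rewrite (le_trans ss)// -sqrtr_sqr ler_wsqrtr// lerDr sqr_ge0.
Qed.

End process.

(** * From decay of cosine integrals to total variation *)

Section geometric_total_variation.
Variables (R : realType) (d : nat) (m : nat -> probability 'rV[R]_d R) (mu : probability 'rV[R]_d R).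

Lemma d_TV_geometric (B a s q M : R) : 0 <= B -> 0 < a -> 0 < s -> 0 < q < 1 -> 0 <= M ->
  (forall n v th, `|int_diff (m n) mu (fun x => cos (dotv v x + th))| <=
    B * q ^+ n * \prod_(k < d) decay a s (v 0 k)) ->
  (forall n, \int[m n]_x (enorm x)%:E <= M%:E)%E ->
  (\int[mu]_x (enorm x)%:E <= M%:E)%E ->
  exists C rho : R, [/\ 0 < C, 0 < rho < 1 &
    forall n, (d_TV (m n) mu <= (C * rho ^+ n)%:E)%E].
Proof.
move=> B0 a0 s0 /andP[q0 q1] M0 hcos hm hmu.
pose rho := q `^ (d.+1%:R^-1).
have rho0 : 0 < rho by exact: powR_gt0.
have rhoE : rho ^+ d.+1 = q.
  by rewrite -powR_mulrn ?(ltW rho0)// -powRrM mulVf ?powRr1 ?(ltW q0).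
have rho1 : rho < 1 by rewrite ltNge; apply/negP => /(exprn_ege1 d.+1); rewrite rhoE leNgt q1.
pose c := fejer_mass R * a * s.
have c0 : 0 < c by rewrite !mulr_gt0// fejer_mass_gt0.
(* The 5 comes from [2 r + 1 <= 2 * (rho ^- n + 1) + 1 <= 5 * rho ^- n]; the summand [2 * M]
   collects the Markov tails of both laws. *)
pose K := B * (5 / c) ^+ d + 2 * M.
have K0 : 0 <= K.
  by rewrite addr_ge0// mulr_ge0// exprn_ge0// divr_ge0// ltW.
exists (2 * K + 1), rho; split; [lra|exact/andP|move=> n].
have rn0 : 0 < rho ^+ n by rewrite exprn_gt0.
have rn1 : rho ^+ n <= 1 by rewrite exprn_ile1// ltW.
apply: (@le_trans _ _ (2 * (K * rho ^+ n))%:E); last first.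
  by rewrite lee_fin mulrA ler_wpM2r ?(ltW rn0)//; lra.
apply: d_TV_le => g ug; rewrite /int_diff lerBlDl.
apply: le_Rintegral_of_continuous ug => h uh ch.
rewrite -lerBlDl; apply: (le_trans (ler_norm _)).
pose r := (Num.truncn (rho ^+ n)^-1).+1.
have i1 : 1 <= (rho ^+ n)^-1 by rewrite invf_ge1.
have r1 : (rho ^+ n)^-1 <= r%:R by apply/ltW; exact: truncnS_gt.
have r2 : r%:R <= (rho ^+ n)^-1 + 1.
  by rewrite /r -natr1 lerD2r truncn_le// ltW// invr_gt0.
have r0 : 0 < r%:R :> R by rewrite ltr0n.
have bq0 : 0 <= B * q ^+ n by rewrite mulr_ge0// exprn_ge0// ltW.
apply: (le_trans (int_diff_interp_limit bq0 a0 s0 (hcos n) r uh ch)).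
have tail (p : probability 'rV[R]_d R) : (\int[p]_x (enorm x)%:E <= M%:E)%E ->
    fine (p (~` [set x : 'rV[R]_d | forall k, `|x 0 k| <= r%:R])) <= M * rho ^+ n.
  move=> hp; apply: (le_trans (markov_box _ hp)) => //.
  by rewrite ler_wpM2l// -[leRHS]invrK lef_pV2// posrE invr_gt0.
have -> : K * rho ^+ n = B * (5 / c) ^+ d * rho ^+ n + M * rho ^+ n + M * rho ^+ n.
  by rewrite /K; ring.
rewrite !lerD ?tail//.
(* Since [q = rho ^+ d.+1], the volume factor [rho ^- (n * d)] still leaves [rho ^+ n]. *)
have -> : B * (5 / c) ^+ d * rho ^+ n = B * q ^+ n * (5 * (rho ^+ n)^-1 / c) ^+ d.
  rewrite -rhoE -exprM mulnC exprM exprS !exprMn !exprVn.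
  have : (rho ^+ n) ^+ d != 0 by rewrite expf_neq0// gt_eqF.
  rewrite [5 ^+ d / _ / _]mulrAC; move: (rho ^+ n ^+ d) (5 ^+ d / c ^+ d) => z k z0.
  by field.
rewrite ler_wpM2l// lerXn2r ?nnegrE ?mulr_ge0 ?invr_ge0 ?(ltW c0) ?(ltW rn0)//.
rewrite ler_wpM2r ?invr_ge0 ?(ltW c0)//.
by rewrite -natr1 -mul2n natrM; lra.
Qed.

End geometric_total_variation.

Lemma Rintegral_distribution_cos dO (Omega : measurableType dO) (R : realType)
  (P : probability Omega R) d (X : {RV P >-> 'rV[R]_d}) (u : 'rV[R]_d) th :
  \int[distribution P X]_x cos (dotv u x + th) = \int[P]_w cos (dotv u (X w) + th).
Proof.
rewrite /Rintegral; congr fine.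
have mc : measurable_fun setT (EFin \o (fun x : 'rV[R]_d => cos (dotv u x + th))).
  by apply/measurable_EFinP; exact: measurable_cos_dotv.
apply: (integral_distribution mc).
apply: (@integrable_bounded _ _ _ P (fun w => cos (dotv u (X w) + th)) 1).
  exact: (measurableT_comp (measurable_cos_dotv u th) (measurable_funPT X)).
by move=> w; exact: cos_max.
Qed.

Lemma enorm_contraction_ge0 (R : realType) d (nu : 'rV[R]_d -> 'rV[R]_d) kappa : (0 < d)%N ->
  (forall x y, enorm (nu x - nu y) <= kappa * enorm (x - y)) -> 0 <= kappa.
Proof.
move=> d0 h; have := le_trans (enorm_ge0 _) (h (const_mx 1) 0).
rewrite pmulr_lge0// subr0; apply: lt_le_trans (coord_le_enorm _ (Ordinal d0)).
by rewrite mxE normr1.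
Qed.

Lemma le_of_geometric (R : realType) (x y K q : R) : `|q| < 1 ->
  (forall n, x <= y + K * q ^+ n) -> x <= y.
Proof.
move=> q1 h; have -> : y = y + K * 0 by rewrite mulr0 addr0.
have cv : y + K * q ^+ n @[n --> \oo] --> y + K * 0.
  by apply: cvgD; [exact: cvg_cst|apply: cvgM; [exact: cvg_cst|exact: cvg_expr]].
by rewrite -(cvg_lim _ cv)//; apply: limr_ge; [exact: cvgP cv|exact: nearW].
Qed.

Theorem theorem3p3 (R : realType) (dO : measure_display)
  (Omega : measurableType dO) (P : probability Omega R)
  (d : nat) (hd : (1 <= d)%N)
  (eps : int -> {RV P >-> 'rV[R]_d})
  (eps_indep : mutually_independent P eps)
  (eps_id : identically_distributed P eps)
  (eps_int : forall i, integrable_rv P (eps i))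
  (b : nat -> R) (hb0 : b 0%N != 0)
  (hb : cvgn (series (fun j => `|b j|)) \/
        [/\ vexpectation P (eps 0) = 0,
            ('E_P[fun w => (enorm (eps 0 w) ^+ 2)%R] < +oo)%E
          & cvgn (series (fun j => b j ^+ 2))])
  (nu : 'rV[R]_d -> 'rV[R]_d) (nu_meas : measurable_fun setT nu)
  (kappa : R) (hkappa : kappa < 1)
  (nu_contr : forall x1 x2, enorm (nu x1 - nu x2) <= kappa * enorm (x1 - x2))
  (X : nat -> {RV P >-> 'rV[R]_d})
  (X0_int : integrable_rv P (X 0%N))
  (X0_indep : independent_of_family P (X 0%N) eps)
  (X_rec : forall n : nat,
     {ae P, forall w, X n.+1 w = nu (X n w) + linear_process b eps n.+1%:Z w})
  (mu : probability 'rV[R]_d R)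
  (mu_lim : exists2 C : R, 0 < C &
     forall n : nat, (W1 (distribution P (X n)) mu <= (C * kappa ^+ n)%:E)%E)
  (gamma Cflat : R) (hgamma : 0 < gamma) (hCflat : 0 < Cflat)
  (phi_decay : forall u : 'rV[R]_d,
     Normc.normc (char_fun P (eps 0) u) <=
       Cflat * (1 + enorm u) `^ (- d%:R - gamma)) :
  exists C' rho : R, [/\ 0 < C', rho < 1 &
    forall n : nat, (d_TV (distribution P (X n)) mu <= (C' * rho ^+ n)%:E)%E].
Proof.
have d0 : 0 < d%:R :> R by rewrite ltr0n.
have [C C0 hW] := mu_lim.
have k0 := enorm_contraction_ge0 hd nu_contr.
(* [kappa] may be 0, whereas the rate [q] below, a real power of it, has to be positive; enlarging
   the rate preserves the Wasserstein bound because [0 <= kappa]. *)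
pose kap := Num.max kappa 2^-1.
have kap0 : 0 < kap by rewrite lt_max invr_gt0 ltr0n orbT.
have kap1 : kap < 1 by rewrite gt_max hkappa invf_lt1// ltr1n.
have {}hW n : (W1 (distribution P (X n)) mu <= (C * kap ^+ n)%:E)%E.
  apply: (le_trans (hW n)); rewrite lee_fin ler_wpM2l ?(ltW C0)// lerXn2r ?nnegrE ?(ltW kap0)//.
  by rewrite le_max lexx.
have conv n : {ae P, forall w, converges eps b n w}.
  have [cb|[mean0 sq0 cb]] := hb; first exact: summable_converges.
  exact: (square_summable_converges eps_indep eps_id eps_int X0_indep _ mean0 sq0 cb).
pose Q (u : 'rV[R]_d) := 2 * Cflat * (1 + `|b 0%N| * enorm u) `^ (- d%:R - gamma).
have hQ n u th : `|\int[distribution P (X n.+1)]_x cos (dotv u x + th)| <= Q u.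
  rewrite Rintegral_distribution_cos.
  apply: (le_trans (process_cos_le_char_fun nu_meas conv X_rec eps_indep eps_id X0_indep n u th)).
  by rewrite /Q -mulrA ler_pM2l// -enormZ; exact: phi_decay.
have hmuQ u th : `|\int[mu]_x cos (dotv u x + th)| <= Q u.
  apply: (@le_of_geometric _ _ _ (d%:R * enorm u * C * kap) kap).
    by rewrite ger0_norm ?(ltW kap0).
  move=> n; have := W1_int_diff_cos (hW n.+1) u th; have := hQ n u th.
  rewrite /int_diff exprS; set I1 := Rintegral _ _ _; set I2 := Rintegral _ _ _.
  move=> h1 h2; rewrite -[I2](subKr I1) (le_trans (ler_normB _ _))// lerD//.
  by rewrite (le_trans h2)// !mulrA.
have [t t01 ht] := decay_interpolation d0 hgamma.
have b0 : 0 < `|b 0%N| by rewrite normr_gt0.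
pose q := kap `^ t.
have q01 : 0 < q < 1.
  have /andP[t0 t1] := t01.
  rewrite powR_gt0//= /q; have <- : 1 `^ t = 1 :> R by rewrite powR1.
  by apply: gt0_ltr_powR; rewrite ?nnegrE ?(ltW kap0).
(* The constant [4 * Cflat] is twice the [2 * Cflat] of [Q], one share for each law; the extra [kap]
   comes from working at index [n + 1]. *)
pose B := (d%:R * C * kap) `^ t * ((4 * Cflat) `^ (1 - t) * `|b 0%N| `^ (- t)).
pose s := gamma / (2 * d%:R).
have s0 : 0 < s by rewrite divr_gt0// mulr_gt0.
have hcos n v th : `|int_diff (distribution P (X n.+1)) mu (fun x => cos (dotv v x + th))| <=
    B * q ^+ n * \prod_(k < d) decay `|b 0%N| s (v 0 k).
  have := ht _ (d%:R * C * kap ^+ n.+1) (4 * Cflat)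
    `|int_diff (distribution P (X n.+1)) mu (fun x => cos (dotv v x + th))| (enorm v) b0.
  have -> : (d%:R * C * kap ^+ n.+1) `^ t = (d%:R * C * kap) `^ t * q ^+ n.
    rewrite exprS mulrA powRM ?exprn_ge0 ?mulr_ge0 ?(ltW C0) ?(ltW kap0)//; congr (_ * _).
    by rewrite -(powR_mulrn n (ltW kap0)) -(powR_mulrn n (powR_ge0 _ _)) -!powRrM [n%:R * _]mulrC.
  move=> H.
  have {}H : `|int_diff (distribution P (X n.+1)) mu (fun x => cos (dotv v x + th))| <=
      B * q ^+ n * (1 + `|b 0%N| * enorm v) `^ (- d%:R - gamma / 2).
    rewrite [B * _]mulrAC; apply: H; rewrite ?enorm_ge0 ?mulr_ge0 ?exprn_ge0 ?(ltW C0) ?(ltW kap0) ?(ltW hCflat)//.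
      by rewrite -!mulrA; have := W1_int_diff_cos (hW n.+1) v th; rewrite -!mulrA [enorm v * _]mulrC -!mulrA.
    apply: (le_trans (ler_normB _ _)).
    apply: (le_trans (lerD (hQ _ _ _) (hmuQ _ _))).
    by rewrite /Q le_eqVlt; apply/orP; left; apply/eqP; ring.
  apply: (le_trans H); rewrite ler_wpM2l ?decay_le_prod//.
  by rewrite !mulr_ge0 ?powR_ge0 ?exprn_ge0//; have /andP[/ltW] := q01.
(* First moments travel from [X 0] to [mu] through the Wasserstein bound at index 0, then from [mu]
   to every [X n] through the reversed bound, so they are uniform in [n]. *)
have [M0 M00 hM0] : exists2 M0, 0 <= M0 & (\int[distribution P (X 0%N)]_x (enorm x)%:E <= M0%:E)%E.
  have me : measurable_fun setT (EFin \o @enorm R d).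
    by apply/measurable_EFinP; exact: measurable_enorm.
  exists (fine (\int[P]_w (enorm (X 0%N w))%:E)%E).
    by apply: fine_ge0; apply: integral_ge0 => w _; rewrite lee_fin enorm_ge0.
  rewrite fineK; last exact: integrable_fin_num X0_int.
  by rewrite (ge0_integral_distribution (X 0%N))// => x; rewrite lee_fin enorm_ge0.
pose M1 := d%:R * (M0 + C * kap ^+ 0 + 1).
have hmu := W1_first_moment (hW 0%N) hM0.
pose M2 := d%:R * (M1 + C + 1).
have M1_ge0 : 0 <= M1 by rewrite mulr_ge0// !addr_ge0 ?mulr_ge0 ?expr0 ?(ltW C0).
have M2_ge0 : 0 <= M2 by rewrite mulr_ge0// !addr_ge0 ?(ltW C0).
have hX n : (\int[distribution P (X n)]_x (enorm x)%:E <= M2%:E)%E.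
  have hW' := le_trans (le_W1_sym _ _) (hW n).
  apply: (le_trans (W1_first_moment hW' hmu)).
  rewrite lee_fin ler_wpM2l// lerD2r lerD2l ler_piMr ?(ltW C0)// exprn_ile1 ?(ltW kap0) ?(ltW kap1)//.
have B0 : 0 <= B by rewrite !mulr_ge0 ?powR_ge0.
have M12 : 0 <= M1 + M2 by rewrite addr_ge0.
have [||K [rho [K0 /andP[rho0 rho1] hK]]] :=
  @d_TV_geometric _ _ (fun n => distribution P (X n.+1)) mu _ _ _ _ _ B0 b0 s0 q01 M12 hcos.
- by move=> n; apply: (le_trans (hX _)); rewrite lee_fin lerDr.
- by apply: (le_trans hmu); rewrite lee_fin lerDl.
(* The value 2 is the trivial bound, used for the initial law; dividing by [rho] compensates the
   shift of the index by one. *)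
exists (Num.max 2 (K / rho)), rho; split => //; first by rewrite lt_max ltr0n.
case=> [|n].
  rewrite expr0 mulr1; apply: (@le_trans _ _ (2 * 1)%:E); last by rewrite lee_fin mulr1 le_max lexx.
  apply: d_TV_le => g ug; rewrite /int_diff.
  have g01 (p : probability 'rV[R]_d R) : 0 <= \int[p]_x g x <= 1.
    rewrite Rintegral_ge0//=; last by move=> x _; have /andP[] := ug.2 x.
    have -> : 1 = \int[p]_x 1 :> R.
      by rewrite Rintegral_cst// mul1r; rewrite [X in fine X](_ : _ = 1%E)//; exact: probability_setT.
    apply: le_Rintegral => //; first exact: integrable_unit_valued.
      by apply: integrable_unit_valued; split => // x; rewrite ler01 lexx.
    by move=> x _; have /andP[] := ug.2 x.
  have /andP[_ h1] := g01 (distribution P (X 0%N)); have /andP[h2 _] := g01 mu.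
  by rewrite lerBlDl (le_trans h1)// lerDr.
apply: (le_trans (hK n)); rewrite lee_fin exprS mulrA ler_wpM2r ?exprn_ge0 ?(ltW rho0)//.
by rewrite -ler_pdivrMr// le_max lexx orbT.
Qed.
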